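(* Let $(\epsilon^*,C^*,\mu^*,w^* )$ be an accumulation point of the infinite sequence $\{(\epsilon^k,C^k,\mu^k,w^k)\}$ generated by the squared smoothing Newton algorithm SN described in the context, and put $v^*=[C^*;w^*]$. Suppose that $z(\mu^*,v^* )>0$. Then the whole sequence converges to $(\epsilon^*,C^*,\mu^*,w^* )$ superlinearly, i.e. $$\left\|\left(\epsilon^{k+1}-\epsilon^*,C^{k+1}-C^*,\mu^{k+1}-\mu^*,w^{k+1}-w^*\right)\right\|=O\left(\left\|\left(\epsilon^{k}-\epsilon^*,C^{k}-C^*,\mu^{k}-\mu^*,w^{k}-w^*\right)\right\|^{1+\tau}\right),$$ where $\tau\in(0,1]$ is the parameter of SN.
   Context: Let $T,m_1,m_2,n$ be positive integers. For $j\in\{1,\dots,T\}$ let $\bar x_i^{(j)}\in\mathbb{R}^n$, $\bar y_i^{(j)}\in\{\pm1\}$ ($1\le i\le m_1$) be validation data and $\hat x_i^{(j)}\in\mathbb{R}^n$, $\hat y_i^{(j)}\in\{\pm1\}$ ($1\le i\le m_2$) be training data. Let $A\in\mathbb{R}^{Tm_1\times Tn}$ be block diagonal with diagonal blocks $A^{(1)},\dots,A^{(T)}$, where $A^{(j)}\in\mathbb{R}^{m_1\times n}$ has rows $A^{(j)}_i=(\bar y_i^{(j)}\bar x_i^{(j)})^\top$. Let $X\in\mathbb{R}^{Tn\times Tm_2}$ be block diagonal with diagonal blocks $X^{(j)}=[\hat x_1^{(j)},\dots,\hat x_{m_2}^{(j)}]\in\mathbb{R}^{n\times m_2}$, and let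 $\hat y\in\mathbb{R}^{Tm_2}$ be the stacked vector of the labels $\hat y_i^{(j)}$. Exponentials and logarithms of vectors are componentwise. Define $f(w):=\mathbf{1}^\top\log(\mathbf{1}+e^{-Aw})$; $h_X(w)\in\mathbb{R}^{Tm_2}$ is obtained by applying $\theta\mapsto\frac{1-e^{-\theta}}{1+e^{-\theta}}$ to each component of $X^\top w$; $g(w):=\frac12X(h_X(w)-\hat y)\in\mathbb{R}^{Tn}$. Let $u(w),q(w)\in\mathbb{R}^{Tm_2}$ be obtained by applying, respectively, $\theta\mapsto(2+e^{-\theta}+e^{\theta})^{-1}$ and $\theta\mapsto\frac{e^{-\theta}(e^{-\theta}-1)}{(1+e^{-\theta})^3}$ to each component of $X^\top w$, and let $p(w)\in\mathbb{R}^{Tm_1}$ be obtained by applying $\theta\mapsto\frac{e^{\theta}}{(1+e^{\theta})^2}$ to each component of $Aw$. The Jacobian of $g$ is $\nabla g(w)=X\,\mathrm{Diag}(u(w))X^\top$. For $v=[C;w]$ put $P(v):=I_{Tn}+C\,\nabla g(w)$ and $$\alpha(\mu,v):=\tfrac1{Tm_1}A^\top\mathrm{Diag}(p(w))A+C\,X\,\mathrm{Diag}(X^\top\mu)\,\mathrm{Diag}(q(w))X^\top,$$ $$z(\mu,v):=g(w)^\top P(v)^{-1}\left(\alpha(\mu,v)P(v)^{-1}g(w)-2\nabla g(w)\mu\right)$$ (defined when $P(v)$ is invertible, e.g. when $C\ge0$; a condition $z(\mu,v)>0$ is understood to include this). The Huber smoothing function of $\max\{0,t\}$ is, for $\epsilon\ne0$: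 $h(\epsilon,t)=t-\frac{|\epsilon|}2$ if $t>|\epsilon|$; $h(\epsilon,t)=\frac{t^2}{2|\epsilon|}$ if $0\le t\le|\epsilon|$; $h(\epsilon,t)=0$ if $t<0$; and $h(0,t)=\max\{0,t\}$. Fix a constant $\kappa>0$ and define on $\mathbb{R}\times\mathbb{R}\times\mathbb{R}^{Tn}\times\mathbb{R}^{Tn}$ $$\hat{\mathcal{E}}(\epsilon,C,\mu,w)=\begin{bmatrix} \epsilon \\ \mathcal{E}(\epsilon,C,\mu,w) \end{bmatrix},\qquad \mathcal{E}(\epsilon,C,\mu,w)=\begin{bmatrix} (1+\kappa|\epsilon|)C-h(\epsilon,C-\mu^\top g(w)) \\ \frac1{Tm_1}\nabla f(w)+(I_{Tn}+C\nabla g(w))\mu \\ w+C\,g(w) \end{bmatrix},$$ and $\psi:=\|\hat{\mathcal{E}}\|^2$ (Euclidean norm). These are continuously differentiable where $\epsilon>0$; $J_{\mathcal{E}}$ is the Jacobian of $\mathcal{E}$ and $\nabla_\epsilon\mathcal{E}$ its partial derivative in $\epsilon$. Algorithm SN. Parameters: $\hat\epsilon\in(0,\infty)$, $r\in(0,1)$, $\hat\eta\in(0,\infty)$ with $\delta:=\sqrt2\max\{r\hat\epsilon,\hat\eta\}<1$; $\hat r\in(0,\infty)$, $\rho\in(0,1)$, $\sigma\in(0,\frac12)$, $\tau\in(0,1]$; a starting point $b^0=(\epsilon^0,C^0,\mu^0,w^0)$ with $\epsilon^0>0$. For $k=0,1,2,\dots$, with $b^k=(\epsilon^k,C^k,\mu^k,w^k)$: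 1. If $\hat{\mathcal{E}}(b^k)=\mathbf{0}$, stop and output $b^k$. 2. Set $\eta_k=\min\{1,\hat r\|\hat{\mathcal{E}}(b^k)\|^{\tau}\}$ and $\zeta_k=r\min\{1,\|\hat{\mathcal{E}}(b^k)\|^{1+\tau}\}$. 3. Set $\Delta\epsilon^k=-\epsilon^k+\zeta_k\hat\epsilon$ and choose (an approximate Newton direction, computed by the bi-conjugate gradient method) $\Delta b^k=(\Delta\epsilon^k,\Delta C^k,\Delta\mu^k,\Delta w^k)$ such that $\mathcal{R}_k:=\mathcal{E}(b^k)+J_{\mathcal{E}}(b^k)\Delta b^k$ satisfies $\|\mathcal{R}_k\|\le\eta_k\|\mathcal{E}(b^k)+\nabla_\epsilon\mathcal{E}(b^k)\Delta\epsilon^k\|$ and $\|\mathcal{R}_k\|\le\hat\eta\|\hat{\mathcal{E}}(b^k)\|$. 4. Let $\ell_k$ be the smallest non-negative integer $\ell$ with $\psi(b^k+\rho^\ell\Delta b^k)\le[1-2\sigma(1-\delta)\rho^\ell]\psi(b^k)$, and set $b^{k+1}=b^k+\rho^{\ell_k}\Delta b^k$. *)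

(* Defs.v *)
From HB Require Import structures.
From mathcomp Require Import all_boot all_order all_algebra.
From mathcomp Require Import all_classical all_reals all_analysis.
From mathcomp Require Import ring lra.

Set Implicit Arguments.
Unset Strict Implicit.
Unset Printing Implicit Defensive.
Import Order.TTheory GRing.Theory Num.Theory.
Import numFieldNormedType.Exports.
Local Open Scope classical_set_scope.
Local Open Scope ring_scope.

(* The stacked dimensions T*m1, T*m2, T*n appear as \sum_(j < T) m1, etc., the
   form in which the library types block matrices. *)

Definition block_diag (R : nzRingType) (T p q : nat) (B : 'I_T -> 'M[R]_(p, q)) :
    'M[R]_(\sum_(j < T) p, \sum_(j < T) q) :=
  \mxblock_(i < T, j < T) (if i == j then B j else 0).

Definition validation_mx (R : realType) (T m1 n : nat)
    (xbar : 'I_T -> 'I_m1 -> 'cV[R]_n) (ybar : 'I_T -> 'I_m1 -> R) :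
    'M[R]_(\sum_(j < T) m1, \sum_(j < T) n) :=
  block_diag (fun j => \matrix_(i < m1) (ybar j i *: xbar j i)^T).

Definition training_mx (R : realType) (T m2 n : nat)
    (xhat : 'I_T -> 'I_m2 -> 'cV[R]_n) :
    'M[R]_(\sum_(j < T) n, \sum_(j < T) m2) :=
  block_diag (fun j => \matrix_(k < n, i < m2) xhat j i k 0).

Definition training_labels (R : realType) (T m2 : nat)
    (yhat : 'I_T -> 'I_m2 -> R) : 'cV[R]_(\sum_(j < T) m2) :=
  \mxcol_(j < T) (\col_(i < m2) yhat j i).

Definition gradient (R : realType) (N : nat) (F : 'cV[R]_N -> R) (w : 'cV[R]_N) :
    'cV[R]_N :=
  \col_i 'D_(delta_mx i 0) F w.

Definition Diag (R : realType) (N : nat) (v : 'cV[R]_N) : 'M[R]_N := diag_mx v^T.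

Definition sqnorm (R : realType) (N : nat) (v : 'cV[R]_N) : R :=
  \sum_i v i 0 ^+ 2.

(* A point b = (eps, C, mu, w). The norm of a product type and of a matrix in
   the library is the sup norm, hence the explicit Euclidean norms below. *)
Notation SN_point R N := (R * R * 'cV[R]_N * 'cV[R]_N)%type.
Notation SN_residual R N := (R * 'cV[R]_N * 'cV[R]_N)%type.

Definition point_norm (R : realType) (N : nat) (b : SN_point R N) : R :=
  let: (eps, C, mu, w) := b in
  Num.sqrt (eps ^+ 2 + C ^+ 2 + sqnorm mu + sqnorm w).

Definition residual_norm (R : realType) (N : nat) (e : SN_residual R N) : R :=
  let: (e1, e2, e3) := e in Num.sqrt (e1 ^+ 2 + sqnorm e2 + sqnorm e3).

Definition huber (R : realType) (eps t : R) : R :=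
  if eps == 0 then Num.max 0 t
  else if `|eps| < t then t - `|eps| / 2
  else if 0 <= t then t ^+ 2 / (2 * `|eps|)
  else 0.

(* M1 = T*m1, M2 = T*m2, N = T*n throughout. *)

Definition f_obj (R : realType) (M1 N : nat) (A : 'M[R]_(M1, N)) (w : 'cV[R]_N) : R :=
  \sum_i ln (1 + expR (- (A *m w) i 0)).

Definition h_vec (R : realType) (N M2 : nat) (X : 'M[R]_(N, M2)) (w : 'cV[R]_N) :
    'cV[R]_M2 :=
  map_mx (fun t => (1 - expR (- t)) / (1 + expR (- t))) (X^T *m w).

Definition g_map (R : realType) (N M2 : nat) (X : 'M[R]_(N, M2)) (y : 'cV[R]_M2)
    (w : 'cV[R]_N) : 'cV[R]_N :=
  2^-1 *: (X *m (h_vec X w - y)).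

Definition u_vec (R : realType) (N M2 : nat) (X : 'M[R]_(N, M2)) (w : 'cV[R]_N) :
    'cV[R]_M2 :=
  map_mx (fun t => (2 + expR (- t) + expR t)^-1) (X^T *m w).

Definition q_vec (R : realType) (N M2 : nat) (X : 'M[R]_(N, M2)) (w : 'cV[R]_N) :
    'cV[R]_M2 :=
  map_mx (fun t => expR (- t) * (expR (- t) - 1) / (1 + expR (- t)) ^+ 3)
    (X^T *m w).

Definition p_vec (R : realType) (M1 N : nat) (A : 'M[R]_(M1, N)) (w : 'cV[R]_N) :
    'cV[R]_M1 :=
  map_mx (fun t => expR t / (1 + expR t) ^+ 2) (A *m w).

(* The Jacobian of g_map; see diff_g_map. *)
Definition nabla_g (R : realType) (N M2 : nat) (X : 'M[R]_(N, M2)) (w : 'cV[R]_N) :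
    'M[R]_N :=
  X *m Diag (u_vec X w) *m X^T.

Definition P_mx (R : realType) (N M2 : nat) (X : 'M[R]_(N, M2))
    (C : R) (w : 'cV[R]_N) : 'M[R]_N :=
  1%:M + C *: nabla_g X w.

Definition alpha_mx (R : realType) (M1 N M2 : nat) (A : 'M[R]_(M1, N))
    (X : 'M[R]_(N, M2)) (C : R) (mu w : 'cV[R]_N) : 'M[R]_N :=
  M1%:R^-1 *: (A^T *m Diag (p_vec A w) *m A)
  + C *: (X *m Diag (X^T *m mu) *m Diag (q_vec X w) *m X^T).

Definition z_val (R : realType) (M1 N M2 : nat) (A : 'M[R]_(M1, N))
    (X : 'M[R]_(N, M2)) (y : 'cV[R]_M2) (C : R) (mu w : 'cV[R]_N) : R :=
  let g := g_map X y w in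
  let Pinv := invmx (P_mx X C w) in
  (g^T *m Pinv *m (alpha_mx A X C mu w *m Pinv *m g - 2 *: (nabla_g X w *m mu)))
    0 0.

Definition z_positive (R : realType) (M1 N M2 : nat) (A : 'M[R]_(M1, N))
    (X : 'M[R]_(N, M2)) (y : 'cV[R]_M2) (b : SN_point R N) : Prop :=
  let: (_, C, mu, w) := b in
  P_mx X C w \in unitmx /\ 0 < z_val A X y C mu w.

Definition E_map (R : realType) (M1 N M2 : nat) (A : 'M[R]_(M1, N))
    (X : 'M[R]_(N, M2)) (y : 'cV[R]_M2) (kappa : R) (b : SN_point R N) :
    SN_residual R N :=
  let: (eps, C, mu, w) := b in
  ((1 + kappa * `|eps|) * C - huber eps (C - (mu^T *m g_map X y w) 0 0),
   M1%:R^-1 *: gradient (f_obj A) w + P_mx X C w *m mu,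
   w + C *: g_map X y w).

Definition E_hat (R : realType) (M1 N M2 : nat) (A : 'M[R]_(M1, N))
    (X : 'M[R]_(N, M2)) (y : 'cV[R]_M2) (kappa : R) (b : SN_point R N) :
    SN_point R N :=
  let: (eps, _, _, _) := b in
  let: (e1, e2, e3) := E_map A X y kappa b in (eps, e1, e2, e3).

Definition psi (R : realType) (M1 N M2 : nat) (A : 'M[R]_(M1, N))
    (X : 'M[R]_(N, M2)) (y : 'cV[R]_M2) (kappa : R) (b : SN_point R N) : R :=
  point_norm (E_hat A X y kappa b) ^+ 2.

Definition nabla_eps_E (R : realType) (M1 N M2 : nat) (A : 'M[R]_(M1, N))
    (X : 'M[R]_(N, M2)) (y : 'cV[R]_M2) (kappa : R) (b : SN_point R N) :
    SN_residual R N :=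
  let: (eps, C, mu, w) := b in
  derive1 (fun s : R => E_map A X y kappa (s, C, mu, w)) eps.

Record SN_params (R : realType) := SNParams {
  sn_eps_hat : R; sn_r : R; sn_eta_hat : R; sn_r_hat : R; sn_rho : R; sn_sigma : R; sn_tau : R }.

Definition SN_delta (R : realType) (pr : SN_params R) : R :=
  Num.sqrt 2 * Num.max (sn_r pr * sn_eps_hat pr) (sn_eta_hat pr).

Definition SN_params_ok (R : realType) (pr : SN_params R) : Prop :=
  [/\ 0 < sn_eps_hat pr,
      0 < sn_r pr < 1,
      0 < sn_eta_hat pr &
      SN_delta pr < 1] /\
  [/\ 0 < sn_r_hat pr,
      0 < sn_rho pr < 1,
      0 < sn_sigma pr < 2^-1 &
      0 < sn_tau pr <= 1].

Definition eta_k (R : realType) (pr : SN_params R) (nE : R) : R :=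
  Num.min 1 (sn_r_hat pr * nE `^ sn_tau pr).

Definition zeta_k (R : realType) (pr : SN_params R) (nE : R) : R :=
  sn_r pr * Num.min 1 (nE `^ (1 + sn_tau pr)).

(* The product J_E(b) d of the Jacobian matrix with a vector is the value
   'd E b d of the differential. *)
Definition SN_direction (R : realType) (M1 N M2 : nat) (A : 'M[R]_(M1, N))
    (X : 'M[R]_(N, M2)) (y : 'cV[R]_M2) (kappa : R) (pr : SN_params R)
    (b d : SN_point R N) : Prop :=
  let E := E_map A X y kappa in
  let nE := point_norm (E_hat A X y kappa b) in
  let eps := b.1.1.1 in
  let deps := d.1.1.1 in
  let Res := E b + 'd E b d in
  [/\ deps = - eps + zeta_k pr nE * sn_eps_hat pr,
      residual_norm Res <=
        eta_k pr nE * residual_norm (E b + deps *: nabla_eps_E A X y kappa b) &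
      residual_norm Res <= sn_eta_hat pr * nE].

Definition SN_armijo (R : realType) (M1 N M2 : nat) (A : 'M[R]_(M1, N))
    (X : 'M[R]_(N, M2)) (y : 'cV[R]_M2) (kappa : R) (pr : SN_params R)
    (b d : SN_point R N) (l : nat) : Prop :=
  psi A X y kappa (b + sn_rho pr ^+ l *: d) <=
    (1 - 2 * sn_sigma pr * (1 - SN_delta pr) * sn_rho pr ^+ l) * psi A X y kappa b.

Definition SN_step (R : realType) (M1 N M2 : nat) (A : 'M[R]_(M1, N))
    (X : 'M[R]_(N, M2)) (y : 'cV[R]_M2) (kappa : R) (pr : SN_params R)
    (b b' : SN_point R N) : Prop :=
  exists (d : SN_point R N) (l : nat),
    [/\ SN_direction A X y kappa pr b d,
        SN_armijo A X y kappa pr b d l,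
        (forall l' : nat, (l' < l)%N -> ~ SN_armijo A X y kappa pr b d l') &
        b' = b + sn_rho pr ^+ l *: d].

(* An infinite run: the stopping test E_hat (b k) = 0 never succeeds. *)
Definition SN_infinite_sequence (R : realType) (M1 N M2 : nat) (A : 'M[R]_(M1, N))
    (X : 'M[R]_(N, M2)) (y : 'cV[R]_M2) (kappa : R) (pr : SN_params R)
    (b : nat -> SN_point R N) : Prop :=
  0 < (b 0%N).1.1.1 /\
  forall k, E_hat A X y kappa (b k) <> 0 /\ SN_step A X y kappa pr (b k) (b k.+1).

Lemma is_diff_coord (R : realType) (m n : nat) (i : 'I_m) (j : 'I_n) (M : 'M[R]_(m, n)) :
  is_diff M (fun B : 'M[R]_(m, n) => B i j : R) (fun B => B i j).
Proof.
have @f : {linear 'M[R]_(m, n) -> R}.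
  by exists (fun B : 'M[R]_(_, _) => B i j); do 2![eexists]; do ?[constructor];
     rewrite ?mxE// => ? *; rewrite ?mxE//; move=> ?; rewrite !mxE.
rewrite (_ : (fun _ => _) = f) //; apply: DiffDef.
  exact/linear_differentiable/coord_continuous.
by rewrite diff_lin //; exact: coord_continuous.
Qed.

Lemma is_diff_sum (R : realType) (V W : normedModType R) (n : nat)
    (F dF : 'I_n -> V -> W) (x : V) :
  (forall i, is_diff x (F i) (dF i)) ->
  is_diff x (\sum_i F i) (\sum_i dF i).
Proof.
move=> H; elim/big_ind2: _ => // [|f1 d1 f2 d2 H1 H2]; first exact: is_diff_cst.
exact: is_diffD.
Qed.

Lemma is_diff_logistic (R : realType) (t : R) :
  is_diff t (fun t : R => (1 - expR (- t)) / (1 + expR (- t)))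
    (fun s => s *: (2 * (2 + expR (- t) + expR t)^-1)).
Proof.
have H : is_derive t 1 (fun t : R => (1 - expR (- t)) / (1 + expR (- t)))
    (2 * (2 + expR (- t) + expR t)^-1).
  have e0 : 1 + expR (- t) != 0 by rewrite gt_eqF // addr_gt0 ?expR_gt0.
  have H1 : is_derive t 1 (fun t : R => expR (- t)) (- expR (- t)).
    have := @is_derive1_comp R expR (fun t => - t) t (expR (- t)) (-1) _ _.
    by rewrite mulrN1; apply.
  pose f := (fun t : R => 1 - expR (- t)).
  pose g := (fun t : R => 1 + expR (- t)).
  have Hf : is_derive t 1 f (expR (- t)).
    rewrite -[X in is_derive _ _ _ X]opprK -[X in is_derive _ _ _ X]add0r.
    by apply: is_deriveB.
  have Hg : is_derive t 1 g (- expR (- t)).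
    rewrite -[X in is_derive _ _ _ X]add0r.
    by apply: is_deriveD.
  have HV : is_derive t 1 (fun x => (g x)^-1) (- (g t) ^- 2 *: (- expR (- t))).
    exact: is_deriveV.
  have := @is_deriveM _ _ f (fun x => (g x)^-1) t 1 _ _ Hf HV.
  move=> HM; apply: (is_derive_eq HM).
  rewrite /f /g; have -> : expR t = (expR (- t))^-1 by rewrite expRN invrK.
  have ep := expR_gt0 (- t).
  move: e0 ep; set e := expR (- t) => e0 ep.
  rewrite -![_ *: _]/(_ * _); field.
  by rewrite gt_eqF //= e0 /= gt_eqF // !addr_gt0 // ?mulr_gt0 // addr_gt0.
apply: DiffDef; first by apply/derivable1_diffP; apply: ex_derive.
rewrite diff1E; last by apply/derivable1_diffP; apply: ex_derive.
by rewrite derive1E (@derive_val _ _ _ _ _ _ _ H).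
Qed.

Lemma diff_g_map (R : realType) (N M2 : nat) (X : 'M[R]_(N, M2)) (y : 'cV[R]_M2)
    (w : 'cV[R]_N) :
  is_diff w (g_map X y) (mulmx (nabla_g X w)).
Proof.
pose ph (t : R) := (1 - expR (- t)) / (1 + expR (- t)).
pose th (k : 'I_M2) := \sum_i X i k *: (fun v : 'cV[R]_N => v i 0).
have thE k v : th k v = (X^T *m v) k 0.
  rewrite /th fct_sumE mxE; apply: eq_bigr => i _; by rewrite mxE.
have dth k v : is_diff v (th k) (th k).
  by apply: is_diff_sum => i; apply: is_diffZ; exact: is_diff_coord.
pose F k := 2^-1 *: ((fun c : R => c *: col k X) \o (ph \o th k - cst (y k 0))).
pose U k v := 2^-1 *: ((th k v *: (2 * u_vec X w k 0)) *: col k X).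
have HF k : is_diff w (F k) (U k).
  have H1 := @is_diff_comp _ _ _ _ (th k) (th k) ph _ w (dth k w)
    (is_diff_logistic (th k w)).
  have H2 := is_diffB H1 (is_diff_cst (y k 0) w).
  have H3 := @is_diff_comp _ _ _ _ _ _ (fun c : R => c *: col k X) _ w H2
    (is_diff_scalel _ _).
  apply: (is_diff_eq (is_diffZ 2^-1 H3)).
  by rewrite subr0 funeqE => v /=; rewrite /U /u_vec [map_mx _ _ _ _]mxE -!thE.
have -> : g_map X y = \sum_k F k.
  rewrite funeqE => v; rewrite fct_sumE /g_map.
  apply/matrixP => i j; rewrite mxE mxE summxE big_distrr /=.
  apply: eq_bigr => k _; rewrite (ord1 j).
  have -> : F k v = 2^-1 *: ((ph (th k v) - y k 0) *: col k X) by [].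
  have -> : (h_vec X v - y) k 0 = ph (th k v) - y k 0 by rewrite !mxE thE mxE.
  by rewrite !mxE [X i k * _]mulrC.
have -> : mulmx (nabla_g X w) = \sum_k U k.
  rewrite funeqE => v; rewrite fct_sumE /nabla_g -!mulmxA /Diag.
  apply/matrixP => i j; rewrite mxE summxE; apply: eq_bigr => k _.
  rewrite mul_diag_mx !mxE (ord1 j) thE !mxE /=.
  rewrite -![_ *: _]/(_ * _).
  by field.
exact: is_diff_sum.
Qed.

(* Main.v *)
(* The Jacobian of E in (C, mu, w) is eliminated explicitly: its kernel equation
   reduces to (1 + kappa eps - s + s z) dC = 0, where s in [0, 1] is the slope of
   the smoothing function. Hence z > 0 at the accumulation point makes the
   Jacobians uniformly invertible nearby, whatever the value of s, that is, also
   at eps = 0.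
   If the merit function stayed away from 0, then so would eps, E would be smooth
   near the accumulation point, and the step lengths would be bounded below
   there: the merit function would drop by a fixed factor infinitely often, a
   contradiction. So the accumulation point bs is a zero of E with eps = 0. There
   the Huber function is positively homogeneous (or affine), so Euler's identity
   gives E b + E'(b) (bs - b) = O(|b - bs|^2), and the inexact Newton step
   satisfies |b + d - bs| = O(|b - bs|^(1 + tau)). Near bs this makes the full
   step acceptable to the line search, and the iterates contract to bs.
   All estimates use the sup norm; Euclidean norms enter only through norm
   equivalence and through convexity of the squared norm. *)
Require Import Defs.
From HB Require Import structures.
From mathcomp Require Import all_boot all_order all_algebra.
From mathcomp Require Import all_classical all_reals all_analysis.
From mathcomp Require Import ring lra.
Set Implicit Arguments.
Unset Strict Implicit.
Unset Printing Implicit Defensive.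
Import Order.TTheory GRing.Theory Num.Theory.
Import numFieldNormedType.Exports.
Local Open Scope classical_set_scope.
Local Open Scope ring_scope.

(** * Two-point Taylor estimates *)

(** The obstacle is that [E] need not be differentiable at [eps = 0], where the limit lies, while it
    is not known beforehand that the accumulation point has [eps = 0]. Only the Huber term and
    [|eps|] are at fault. Hence the Jacobian is written as [jacobian_with s e], with the two Huber
    partials as free bounded numbers: estimates at [bs] are uniform in them and are carried over to
    a nearby [b] with the same [s] and [e], so jumps of the partials are never compared. The
    exponent has three sources: [eta_k], of order [nE^tau], multiplies a quantity of order
    [|b - bs|]; the target of [eps], a multiple of [zeta_k], is of order [nE^(1 + tau)]; the
    quadratic remainder is absorbed since [tau <= 1]. Here [nE] is the Euclidean norm of [Ehat b].
    Near [bs] and for [eps > 0] it is of the same order as [|b - bs|], which turns contraction of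
    the distance into decrease of the merit function. *)

Definition linear_map (R : realType) (V W : lmodType R) (L : V -> W) : Prop :=
  forall a u v, L (a *: u + v) = a *: L u + L v.

Section LinearMap.
Variables (R : realType) (V W : lmodType R) (L : V -> W).
Hypothesis Llin : linear_map L.

Lemma linear_map0 : L 0 = 0.
Proof.
have := Llin 1 0 0; rewrite !scale1r addr0 => /(congr1 (fun z => z - L 0)).
by rewrite subrr addrK.
Qed.

Lemma linear_mapZ a u : L (a *: u) = a *: L u.
Proof. by rewrite -[a *: u]addr0 Llin linear_map0 !addr0. Qed.

Lemma linear_mapD u v : L (u + v) = L u + L v.
Proof. by rewrite -[u in LHS]scale1r Llin scale1r. Qed.

Lemma linear_mapN u : L (- u) = - L u.
Proof. by rewrite -scaleN1r linear_mapZ scaleN1r. Qed.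

Lemma linear_mapB u v : L (u - v) = L u - L v.
Proof. by rewrite linear_mapD linear_mapN. Qed.

End LinearMap.

(* The two-point Taylor estimate makes [dF] the derivative of [F] on the whole
   ball; no convexity or mean value theorem is needed to compose such
   estimates. *)
Definition c11_on (R : realType) (V W : normedModType R) (r K : R)
    (F : V -> W) (dF : V -> V -> W) (x0 : V) : Prop :=
  forall x, `|x - x0| < r ->
    [/\ linear_map (dF x), forall d, `|dF x d| <= K * `|d| &
      forall y, `|y - x0| < r ->
        `|F y - F x - dF x (y - x)| <= K * `|y - x| ^+ 2].

Definition c11 (R : realType) (V W : normedModType R)
    (F : V -> W) (dF : V -> V -> W) (x0 : V) : Prop :=
  exists r K, [/\ 0 < r, 0 <= K & c11_on r K F dF x0].

(** Products and compositions also need a bound on values and a Lipschitz bound. A single constant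
    serves all estimates, so two functions can share one by taking a maximum. *)
Definition c11_bounded_on (R : realType) (V W : normedModType R) (r K : R)
    (F : V -> W) (dF : V -> V -> W) (x0 : V) : Prop :=
  [/\ c11_on r K F dF x0,
      forall x, `|x - x0| < r -> `|F x| <= K &
      forall x y, `|x - x0| < r -> `|y - x0| < r -> `|F y - F x| <= K * `|y - x|].

Section C11Basics.
Variables (R : realType) (V W : normedModType R).
Implicit Types (F G : V -> W) (dF dG : V -> V -> W).

Lemma c11_bounded_mono r K r' K' F dF x0 : r' <= r -> K <= K' ->
  c11_bounded_on r K F dF x0 -> c11_bounded_on r' K' F dF x0.
Proof.
move=> rr KK [H1 H2 H3]; split.
- move=> x xr; have [L B T] := H1 x (lt_le_trans xr rr); split => // [d|y yr].
    by apply: le_trans (B d) _; rewrite ler_wpM2r.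
  apply: le_trans (T y (lt_le_trans yr rr)) _.
  by rewrite ler_wpM2r ?exprn_ge0.
- by move=> x xr; apply: le_trans (H2 _ (lt_le_trans xr rr)) KK.
- move=> x y xr yr.
  apply: le_trans (H3 x y (lt_le_trans xr rr) (lt_le_trans yr rr)) _.
  by rewrite ler_wpM2r.
Qed.

(** On a ball of radius at most 1 increments have norm at most 2, so the quadratic remainder is at
    most [2 K] times the increment; the linear part adds [K], whence the Lipschitz constant
    [3 K]. *)
Lemma c11_bounded F dF x0 : c11 F dF x0 ->
  exists r K, [/\ 0 < r, r <= 1, 1 <= K & c11_bounded_on r K F dF x0].
Proof.
move=> [r [K [r0 K0 H]]].
have Hx0 : `|x0 - x0| < r by rewrite subrr normr0.
set r' := Num.min r 1.
have r'r : r' <= r by rewrite ge_min lexx.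
have r'1 : r' <= 1 by rewrite ge_min lexx orbT.
have r'0 : 0 < r' by rewrite lt_min r0 ltr01.
have lip x y : `|x - x0| < r' -> `|y - x0| < r' -> `|F y - F x| <= 3 * K * `|y - x|.
  move=> xr yr; have [L B T] := H x (lt_le_trans xr r'r).
  have -> : F y - F x = (F y - F x - dF x (y - x)) + dF x (y - x) by rewrite subrK.
  apply: le_trans (ler_normD _ _) _.
  have h2 : `|y - x| <= 2.
    have -> : y - x = (y - x0) - (x - x0) by rewrite opprB addrA subrK.
    apply: le_trans (ler_normB _ _) _.
    have := ltW (lt_le_trans xr r'1); have := ltW (lt_le_trans yr r'1); lra.
  have := T y (lt_le_trans yr r'r); have := B (y - x).
  have : K * `|y - x| ^+ 2 <= 2 * K * `|y - x|.
    rewrite expr2 [2 * K]mulrC -!mulrA ler_wpM2l // ler_wpM2r //.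
  lra.
have x0r : `|x0 - x0| < r' by rewrite subrr normr0.
(* [3 K + |F x0|] bounds the values on a radius of at most 1; the last summand gives [1 <= K], which
   makes later divisions by the constant safe. *)
exists r', (3 * K + `|F x0| + 1); split => //.
  by rewrite lerDr addr_ge0 // mulr_ge0.
have KK : K <= 3 * K + `|F x0| + 1 by have := normr_ge0 (F x0); lra.
have K3 : 3 * K <= 3 * K + `|F x0| + 1 by have := normr_ge0 (F x0); lra.
split.
- move=> x xr; have [L B T] := H x (lt_le_trans xr r'r); split => // [d|y yr].
    by apply: le_trans (B d) _; rewrite ler_wpM2r.
  apply: le_trans (T y (lt_le_trans yr r'r)) _.
  by rewrite ler_wpM2r ?exprn_ge0.
- move=> x xr; have := lip x0 x x0r xr.
  have -> : F x = (F x - F x0) + F x0 by rewrite subrK.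
  have := ler_normD (F x - F x0) (F x0); rewrite subrK.
  have : 3 * K * `|x - x0| <= 3 * K by rewrite ler_piMr ?mulr_ge0 // ltW // (lt_le_trans xr).
  lra.
- move=> x y xr yr; apply: le_trans (lip x y xr yr) _.
  by rewrite ler_wpM2r.
Qed.

End C11Basics.

Lemma c11_bounded2 (R : realType) (V W W' : normedModType R)
    (F : V -> W) dF (G : V -> W') dG (x0 : V) :
  c11 F dF x0 -> c11 G dG x0 ->
  exists r K, [/\ 0 < r, r <= 1, 1 <= K, c11_bounded_on r K F dF x0 &
    c11_bounded_on r K G dG x0].
Proof.
move=> /c11_bounded[r1 [K1 [r10 r11 K11 H1]]] /c11_bounded[r2 [K2 [r20 r21 K21 H2]]].
exists (Num.min r1 r2), (Num.max K1 K2); split.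
- by rewrite lt_min r10.
- by rewrite ge_min r11.
- by rewrite le_max K11.
- by apply: c11_bounded_mono H1; rewrite ?ge_min ?le_max lexx.
- by apply: c11_bounded_mono H2; rewrite ?ge_min ?le_max lexx orbT.
Qed.

Section C11Calculus.
Variables (R : realType) (V W : normedModType R).
Implicit Types (F G : V -> W) (dF dG : V -> V -> W).

Lemma c11_eq_near F dF G dG x0 (s : R) : 0 < s ->
  (forall x, `|x - x0| < s -> F x = G x) ->
  (forall x d, `|x - x0| < s -> dF x d = dG x d) ->
  c11 F dF x0 -> c11 G dG x0.
Proof.
move=> s0 FG dFG [r [K [r0 K0 H]]].
exists (Num.min r s), K; split => //; first by rewrite lt_min r0.
move=> x; rewrite lt_min => /andP[xr xs].
have [L B T] := H x xr; split => [a u v|d|y].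
- by rewrite -!dFG.
- by rewrite -dFG.
- by rewrite lt_min => /andP[yr ys]; rewrite -dFG // -!FG //; exact: T.
Qed.

Lemma c11_eq F dF G dG x0 :
  (forall x, F x = G x) -> (forall x d, dF x d = dG x d) ->
  c11 F dF x0 -> c11 G dG x0.
Proof. by move=> FG dFG; apply: (@c11_eq_near _ _ _ _ _ 1). Qed.

Lemma c11_cst (c : W) (x0 : V) : c11 (fun=> c) (fun _ _ => 0) x0.
Proof.
exists 1, 0; split => // x _; split => [a u v|d|y _].
- by rewrite scaler0 addr0.
- by rewrite normr0 mul0r.
- by rewrite subrr subr0 normr0 mul0r.
Qed.

Lemma c11_linear (L : V -> W) (K : R) (x0 : V) : linear_map L ->
  (forall d, `|L d| <= K * `|d|) -> c11 L (fun=> L) x0.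
Proof.
move=> Llin LK; exists 1, `|K|; split => // x _; split => [//|d|y _].
  by apply: le_trans (LK d) _; rewrite ler_wpM2r // ler_norm.
by rewrite (linear_mapB Llin) subrr normr0 mulr_ge0.
Qed.

Lemma c11D F dF G dG x0 : c11 F dF x0 -> c11 G dG x0 ->
  c11 (fun x => F x + G x) (fun x d => dF x d + dG x d) x0.
Proof.
move=> HF HG; have [r [K [r0 _ K1 [FT _ _] [GT _ _]]]] := c11_bounded2 HF HG.
exists r, (2 * K); split; [by []|by lra|].
move=> x xr; have [FL FB FY] := FT x xr; have [GL GB GY] := GT x xr.
split => [a u v|d|y yr].
- by rewrite FL GL scalerDr addrACA.
- by apply: le_trans (ler_normD _ _) _; have := FB d; have := GB d; lra.
- rewrite [X in `|X|](_ : _ = (F y - F x - dF x (y - x)) + (G y - G x - dG x (y - x))).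
    apply: le_trans (ler_normD _ _) _; have := FY y yr; have := GY y yr; lra.
  by rewrite !opprD (addrACA (F y)) [LHS]addrACA.
Qed.

Lemma c11_sum (I : Type) (s : seq I) (F : I -> V -> W) (dF : I -> V -> V -> W) (x0 : V) :
  (forall i, c11 (F i) (dF i) x0) ->
  c11 (fun x => \sum_(i <- s) F i x) (fun x d => \sum_(i <- s) dF i x d) x0.
Proof.
move=> H; elim: s => [|i s IH].
  by apply: c11_eq (c11_cst 0 x0) => [x|x d]; rewrite big_nil.
by apply: c11_eq (c11D (H i) IH) => [x|x d]; rewrite big_cons.
Qed.

(* With [h := y - x]: f y G y - f x G x = f x (G y - G x) + (f y - f x) G x
   + (f y - f x) (G y - G x). *)
Lemma c11Z (f : V -> R) df G dG x0 : c11 f df x0 -> c11 G dG x0 ->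
  c11 (fun x => f x *: G x) (fun x d => f x *: dG x d + df x d *: G x) x0.
Proof.
move=> Hf HG; have [r [K [r0 _ K1 [fT fb fl] [GT Gb Gl]]]] := c11_bounded2 Hf HG.
have K0 : 0 <= K by lra.
exists r, (3 * K ^+ 2); split => //; first by rewrite mulr_ge0 // exprn_ge0.
move=> x xr; have [fL fB fY] := fT x xr; have [GL GB GY] := GT x xr.
split => [a u v|d|y yr].
- rewrite fL GL !scalerDr scalerDl !scalerA [f x * a]mulrC -!addrA; congr (_ + _).
  by rewrite addrCA.
- apply: le_trans (ler_normD _ _) _; rewrite !normrZ.
  have -> : 3 * K ^+ 2 * `|d| = K * (K * `|d|) + (K * `|d|) * K + K ^+ 2 * `|d| by ring.
  apply: ler_wpDr; first by rewrite mulr_ge0 // exprn_ge0.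
  by apply: lerD; apply: ler_pM => //; rewrite ?fb ?Gb ?fB ?GB.
- set h := y - x.
  rewrite [X in `|X|](_ : _ = f x *: (G y - G x - dG x h) +
      (f y - f x - df x h) *: G x + (f y - f x) *: (G y - G x)).
    have -> : 3 * K ^+ 2 * `|h| ^+ 2 =
      K * (K * `|h| ^+ 2) + (K * `|h| ^+ 2) * K + (K * `|h|) * (K * `|h|) by ring.
    apply: le_trans (ler_normD _ _) _; apply: lerD; last first.
      by rewrite normrZ; apply: ler_pM => //; rewrite ?fl ?Gl.
    apply: le_trans (ler_normD _ _) _; rewrite !normrZ.
    by apply: lerD; apply: ler_pM => //; rewrite ?fb ?Gb ?fY ?GY.
  have e (a b c : R) (g1 g2 g3 : W) :
      b *: g2 - a *: g1 - (a *: g3 + c *: g1) =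
      a *: (g2 - g1 - g3) + (b - a - c) *: g1 + (b - a) *: (g2 - g1).
    have -> : b *: g2 - a *: g1 = a *: (g2 - g1) + (b - a) *: g1 + (b - a) *: (g2 - g1).
      rewrite -addrA -scalerDr [g1 + _]addrC subrK scalerBr scalerBl.
      by rewrite addrC addrA subrK.
    rewrite (scalerBr a _ g3) (scalerBl (b - a) c) opprD addrA.
    by rewrite [LHS](ACl ((1*4)*(2*5)*3)).
  exact: e.
Qed.

End C11Calculus.

Section C11Composition.
Variables (R : realType) (V W W' : normedModType R).

Lemma c11_comp (F : V -> W) dF (G : W -> W') dG x0 :
  c11 F dF x0 -> c11 G dG (F x0) ->
  c11 (fun x => G (F x)) (fun x d => dG (F x) (dF x d)) x0.
Proof.
move=> /c11_bounded[r1 [K [r10 _ K1 [FT _ Fl]]]].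
move=> /c11_bounded[r2 [L [r20 _ L1 [GT _ _]]]].
have K0 : 0 < K by lra.
have L0 : 0 < L by lra.
pose r := Num.min r1 (r2 / K).
have rr1 : r <= r1 by rewrite ge_min lexx.
have x0r : `|x0 - x0| < r1 by rewrite subrr normr0.
have Fr x : `|x - x0| < r -> `|F x - F x0| < r2.
  move=> xr; apply: le_lt_trans (Fl _ _ x0r (lt_le_trans xr rr1)) _.
  by rewrite mulrC -ltr_pdivlMr // (lt_le_trans xr) // ge_min lexx orbT.
(* [L K^2] comes from the remainder of [G] at the increment of [F], and [L K] from [dG] applied to
   the remainder of [F]. *)
exists r, (L * K ^+ 2 + L * K); split.
- by rewrite lt_min r10 divr_gt0.
- by rewrite addr_ge0 // mulr_ge0 ?exprn_ge0 // ltW.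
move=> x xr; have xr1 := lt_le_trans xr rr1.
have [FL FB FY] := FT x xr1; have [GL GB GY] := GT _ (Fr x xr).
have LK0 : 0 <= L * K ^+ 2 by rewrite mulr_ge0 ?exprn_ge0 // ltW.
split => [a u v|d|y yr].
- by rewrite FL GL.
- apply: le_trans (GB _) _; rewrite mulrDl; apply: ler_wpDl.
    by rewrite mulr_ge0.
  by rewrite -mulrA ler_wpM2l ?FB // ltW.
- have yr1 := lt_le_trans yr rr1.
  rewrite [X in `|X|](_ : _ = (G (F y) - G (F x) - dG (F x) (F y - F x)) +
     dG (F x) (F y - F x - dF x (y - x))); last first.
    by rewrite (linear_mapB GL (F y - F x)) addrA subrK.
  apply: le_trans (ler_normD _ _) _; rewrite mulrDl; apply: lerD.
    apply: le_trans (GY _ (Fr y yr)) _.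
    rewrite -mulrA ler_wpM2l ?(ltW L0) // -exprMn.
    by rewrite lerXn2r ?nnegrE ?mulr_ge0 ?(ltW K0) // Fl.
  by apply: le_trans (GB _) _; rewrite -mulrA ler_wpM2l ?(ltW L0) // FY.
Qed.

Lemma norm_pair_le (p : W * W') (c : R) :
  (`|p| <= c) = (`|p.1| <= c) && (`|p.2| <= c).
Proof. by rewrite prod_normE ge_max. Qed.

Lemma c11_pair (F : V -> W) dF (G : V -> W') dG x0 :
  c11 F dF x0 -> c11 G dG x0 ->
  c11 (fun x => (F x, G x)) (fun x d => (dF x d, dG x d)) x0.
Proof.
move=> HF HG; have [r [K [r0 _ K1 [FT _ _] [GT _ _]]]] := c11_bounded2 HF HG.
exists r, K; split => //; first by lra.
move=> x xr; have [FL FB FY] := FT x xr; have [GL GB GY] := GT x xr.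
split => [a u v|d|y yr].
- by rewrite FL GL.
- by rewrite norm_pair_le FB GB.
- by rewrite norm_pair_le /= FY // GY.
Qed.

End C11Composition.

Section C11Derivative.
Variables (R : realType) (V W : normedModType R) (F : V -> W) (dF : V -> V -> W).

(* Compare the Taylor expansions of [F] at [y] and at [x0] along the increment
   [(|y - x0| / |d|) d]. *)
Lemma c11_derivative_lipschitz x0 : c11 F dF x0 ->
  exists r K, [/\ 0 < r, 0 <= K & forall y d, `|y - x0| < r ->
    `|dF y d - dF x0 d| <= K * `|y - x0| * `|d|].
Proof.
move=> [r [K [r0 K0 H]]].
(* The increment [e] is as long as [y - x0], so half the radius keeps [y + e] in the ball. The
   remainders at [y + e] from [x0], at [y + e] from [y] and at [y] from [x0] contribute 4, 1 and
   1. *)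
exists (r / 2), (6 * K); split; [by rewrite divr_gt0|by rewrite mulr_ge0|].
move=> y d yr2.
have yr : `|y - x0| < r by lra.
have x0r : `|x0 - x0| < r by rewrite subrr normr0.
have [L0 B0 T0] := H x0 x0r; have [Ly By Ty] := H y yr.
have [->|yx0] := eqVneq y x0; first by rewrite !subrr !normr0 mulr0 mul0r.
have [->|d0] := eqVneq d 0.
  by rewrite (linear_map0 Ly) (linear_map0 L0) subrr !normr0 mulr0.
have nd : 0 < `|d| by rewrite normr_gt0.
have nh : 0 < `|y - x0| by rewrite normr_gt0 subr_eq0.
set s := `|y - x0| / `|d|.
have s0 : 0 < s by rewrite divr_gt0.
have ns : `|s *: d| = `|y - x0|.
  by rewrite normrZ gtr0_norm // /s mulfVK // gt_eqF.
set e := s *: d.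
have yer : `|y + e - x0| < r.
  rewrite -addrA [e - x0]addrC addrA; apply: le_lt_trans (ler_normD _ _) _.
  by rewrite ns; lra.
have E1 := Ty (y + e) yer.
have E2 := T0 (y + e) yer.
have E3 := T0 y yr.
rewrite [y + e - y]addrC addKr ns in E1.
have nE : `|y + e - x0| <= 2 * `|y - x0|.
  rewrite -addrA [e - x0]addrC addrA; apply: le_trans (ler_normD _ _) _.
  by rewrite ns; lra.
have E2' : `|F (y + e) - F x0 - dF x0 (y + e - x0)| <= 4 * K * `|y - x0| ^+ 2.
  apply: le_trans E2 _; rewrite [4 * K]mulrC -mulrA ler_wpM2l //.
  have -> : 4 * `|y - x0| ^+ 2 = (2 * `|y - x0|) ^+ 2 by ring.
  by rewrite lerXn2r ?nnegrE ?mulr_ge0.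
have key : s *: (dF y d - dF x0 d) =
    (F (y + e) - F x0 - dF x0 (y + e - x0)) - (F (y + e) - F y - dF y e)
    - (F y - F x0 - dF x0 (y - x0)).
  rewrite scalerBr -(linear_mapZ Ly) -(linear_mapZ L0) -/e.
  have -> : y + e - x0 = e + (y - x0) by rewrite addrAC addrC.
  rewrite (linear_mapD L0) !opprD !opprK !addrA.
  by rewrite [RHS](ACl (7*3*1*5*6*8*9*2*10*4)) /= !addrK.
rewrite -(ler_pM2l s0) -{1}(gtr0_norm s0) -normrZ key.
have -> : s * (6 * K * `|y - x0| * `|d|) = 6 * K * `|y - x0| ^+ 2.
  by rewrite /s; field; rewrite gt_eqF.
apply: le_trans (ler_normB _ _) _.
have := ler_normB (F (y + e) - F x0 - dF x0 (y + e - x0)) (F (y + e) - F y - dF y e).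
lra.
Qed.

End C11Derivative.

(** Bridge to the differential of the library, in terms of which [SN_direction] and [nabla_eps_E]
    are stated. *)
Lemma c11_is_diff (R : realType) (V W : normedModType R) (F : V -> W)
    (dF : V -> V -> W) (x0 : V) : c11 F dF x0 -> is_diff x0 F (dF x0).
Proof.
move=> [r [K [r0 K0 H]]].
have x0r : `|x0 - x0| < r by rewrite subrr normr0.
have [L B T] := H x0 x0r.
pose dfM := GRing.isLinear.Build _ _ _ _ (dF x0) L.
pose df : {linear V -> W} := HB.pack (dF x0) dfM.
have dfc : continuous df.
  apply: bounded_linear_continuous; exists K; split; first exact: num_real.
  move=> K' KK'; apply/nbhs_ballP; exists 1 => //= x.
  rewrite -ball_normE /= sub0r normrN => /ltW x1.
  by apply: le_trans (B x) _; apply: le_trans (ltW KK'); rewrite ler_piMr.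
have dfo : F \o shift x0 = cst (F x0) + df +o_ 0 id.
  apply/eqaddoP => e e0.
  apply/nbhs_ballP; exists (Num.min r (e / (K + 1))).
    by rewrite /= lt_min r0 divr_gt0 // ltr_wpDl.
  move=> h; rewrite -ball_normE /= sub0r normrN lt_min => /andP[hr he].
  have hxr : `|h + x0 - x0| < r by rewrite addrK.
  have := T _ hxr; rewrite addrK => Th.
  rewrite !fctE /= opprD addrA; apply: le_trans Th _.
  rewrite expr2 mulrA ler_wpM2r //.
  move: he; rewrite ltr_pdivlMr ?ltr_wpDl // mulrDr mulr1 mulrC => /ltW.
  by apply: le_trans; rewrite lerDl.
have dE := diff_unique dfc dfo.
split; last exact: dE.
by apply/diff_locallyP; rewrite dE.
Qed.

Section C11Scalar.
Variable R : realType.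
Implicit Type x : R.

(** The radius 1/4 keeps increments [h] below 1/2 in absolute value. Then [1 - h <= exp (- h)] gives
    [exp h <= 1 / (1 - h)], so [exp h - 1 - h <= h^2 / (1 - h) <= 2 h^2]. *)
Lemma c11_expR (x0 : R) : c11 (@expR R) (fun x d => expR x * d) x0.
Proof.
exists 4^-1, (2 * expR (x0 + 1)); split; [lra|by rewrite mulr_ge0 ?expR_ge0|].
move=> x; rewrite ltr_norml => /andP[x1 x2].
have ex : expR x <= expR (x0 + 1) by rewrite ler_expR; lra.
have e0 := expR_ge0 (x0 + 1).
split => [a u v|d|y].
- by rewrite mulrDr -![_ *: _]/(_ * _) mulrCA.
- rewrite normrM ger0_norm ?expR_ge0 // ler_wpM2r //; lra.
- rewrite ltr_norml => /andP[y1 y2].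
  set h := y - x.
  have -> : expR y = expR x * expR h by rewrite -expRD /h subrKC.
  have -> : expR x * expR h - expR x - expR x * h = expR x * (expR h - 1 - h) by ring.
  have h1 : 1 + h <= expR h := expR_ge1Dx h.
  have hn : 1 - h <= expR (- h) := expR_ge1Dx (- h).
  have hi : - 2^-1 < h < 2^-1 by rewrite /h; apply/andP; split; lra.
  have h2 : expR h - 1 - h <= 2 * h ^+ 2.
    have /andP[hi1 hi2] := hi.
    have eh := expR_gt0 h.
    have : (1 - h) * expR h <= 1.
      by rewrite -[leRHS](expRxMexpNx_1 h) [leRHS]mulrC ler_wpM2r // ltW.
    have : 0 <= h ^+ 2 by exact: sqr_ge0.
    have -> : h ^+ 2 = h * h by [].
    nra.
  rewrite normrM ger0_norm ?expR_ge0 // (@ger0_norm _ (_ - _ - _)); last by lra.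
  rewrite -normrX (@ger0_norm _ (h ^+ 2)) ?sqr_ge0 //.
  have -> : 2 * expR (x0 + 1) * h ^+ 2 = expR (x0 + 1) * (2 * h ^+ 2) by ring.
  by apply: ler_pM => //; rewrite ?expR_ge0 //; lra.
Qed.

Lemma c11_inv (x0 : R) : 0 < x0 -> c11 (fun x : R => x^-1) (fun x d => - x ^- 2 * d) x0.
Proof.
move=> p0; set m := x0 / 2.
have m0 : 0 < m by rewrite divr_gt0.
exists m, (m ^- 2 + m ^- 3); split => //.
  by rewrite addr_ge0 // invr_ge0 exprn_ge0 // ltW.
have big x : `|x - x0| < m -> m < x.
  rewrite ltr_norml => /andP[h _]; rewrite /m in h *; lra.
have m20 : 0 <= m ^- 2 by rewrite invr_ge0 exprn_ge0 // ltW.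
have m30 : 0 <= m ^- 3 by rewrite invr_ge0 exprn_ge0 // ltW.
move=> x /big mx; have x0' := lt_trans m0 mx; split => [a u v|d|y /big my].
- by rewrite mulrDr -![_ *: _]/(_ * _) mulrCA.
- rewrite normrM normrN ler_wpM2r // ger0_norm; last first.
    by rewrite invr_ge0 exprn_ge0 // ltW.
  apply: ler_wpDr => //.
  by rewrite lef_pV2 ?posrE ?exprn_gt0 // lerXn2r ?nnegrE // ltW.
- have y0' := lt_trans m0 my.
  have -> : y^-1 - x^-1 - - x ^- 2 * (y - x) = (x ^+ 2 * y)^-1 * (y - x) ^+ 2.
    by field; rewrite !gt_eqF.
  rewrite normrM normrX ler_wpM2r ?exprn_ge0 // ger0_norm; last first.
    by rewrite invr_ge0 mulr_ge0 ?exprn_ge0 // ltW.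
  apply: ler_wpDl => //.
  rewrite lef_pV2 ?posrE ?mulr_gt0 ?exprn_gt0 // exprSr.
  by apply: ler_pM; rewrite ?exprn_ge0 ?lerXn2r ?nnegrE // ltW.
Qed.

(** Squaring smooths the kink of the positive part enough for a two-point estimate. Through [huberE]
    this is all the smoothness that the Huber function requires. *)
Lemma c11_sqr_pos_part (x0 : R) :
  c11 (fun x : R => Num.max 0 x ^+ 2) (fun x d => 2 * Num.max 0 x * d) x0.
Proof.
exists 1, (2 * (`|x0| + 1) + 1); split; [by []|by have := normr_ge0 x0; lra|].
move=> x xr.
have m0 (z : R) : 0 <= Num.max 0 z by rewrite le_max lexx.
have mx : Num.max 0 x <= `|x0| + 1.
  have -> : x = (x - x0) + x0 by rewrite subrK.
  rewrite ge_max addr_ge0 //=.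
  by have := ler_norm (x - x0); have := ler_norm x0; lra.
split => [a u v|d|y _].
- by rewrite mulrDr -![_ *: _]/(_ * _) mulrCA.
- rewrite normrM ler_wpM2r // ger0_norm ?mulr_ge0 //; lra.
- apply: (@le_trans _ _ (`|y - x| ^+ 2)); last first.
    rewrite ler_peMl ?exprn_ge0 //; have := normr_ge0 x0; lra.
  rewrite -normrX (@ger0_norm _ ((y - x) ^+ 2)) ?sqr_ge0 //.
  have sq := sqr_ge0 (y - x).
  have [y0|y0] := leP y 0; have [z0|z0] := leP x 0; rewrite ?ler_norml; apply/andP; split; nra.
Qed.

End C11Scalar.

(** * Smoothness of the data of the problem *)

Section MatrixNorm.
Variable R : realType.

Lemma mx_coord_le m n (v : 'M[R]_(m, n)) i j : `|v i j| <= `|v|.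
Proof.
rewrite [leRHS]/Num.norm /= mx_normrE; apply/bigmax_geP; right => /=.
by exists (i, j).
Qed.

Lemma mx_norm_le m n (v : 'M[R]_(m, n)) (c : R) : 0 <= c ->
  (forall i j, `|v i j| <= c) -> `|v| <= c.
Proof.
move=> c0 H; rewrite [leLHS]/Num.norm /= mx_normrE.
by apply/bigmax_leP; split => // -[i j] _; exact: H.
Qed.

Lemma mulmx_bounded m n (M : 'M[R]_(m, n)) :
  exists2 K : R, 0 <= K & forall v : 'cV[R]_n, `|M *m v| <= K * `|v|.
Proof.
exists (\sum_i \sum_j `|M i j|) => [|v].
  by apply: sumr_ge0 => i _; apply: sumr_ge0.
apply: mx_norm_le => [|i j].
  by rewrite mulr_ge0 // sumr_ge0 // => i _; apply: sumr_ge0.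
rewrite mxE (le_trans (ler_norm_sum _ _ _)) //.
rewrite (@le_trans _ _ ((\sum_k `|M i k|) * `|v|)) //.
  rewrite mulr_suml; apply: ler_sum => k _.
  by rewrite normrM ler_wpM2l // mx_coord_le.
rewrite ler_wpM2r // (bigD1 i) //= lerDl sumr_ge0 // => k _.
exact: sumr_ge0.
Qed.

End MatrixNorm.

Section C11Matrix.
Variables (R : realType) (V : normedModType R).

Lemma c11_col n (F : 'I_n -> V -> R) (dF : 'I_n -> V -> V -> R) (x0 : V) :
  (forall i, c11 (F i) (dF i) x0) ->
  c11 (fun x => \col_i F i x) (fun x d => \col_i dF i x d) x0.
Proof.
move=> H.
have Hi i := c11Z (H i) (c11_cst (delta_mx i 0 : 'cV[R]_n) x0).
have colE (f : 'I_n -> R) : \sum_i f i *: delta_mx i 0 = \col_i f i.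
  apply/colP => j; rewrite summxE (bigD1 j) //= big1 ?addr0.
    by rewrite !mxE !eqxx mulr1.
  by move=> i ij; rewrite !mxE eq_sym (negbTE ij) mulr0.
apply: c11_eq (c11_sum (index_enum 'I_n) Hi) => [x|x d]; first exact: colE.
rewrite -colE; apply: eq_bigr => i _.
by rewrite scaler0 add0r.
Qed.

Lemma c11_mulmx m n (M : 'M[R]_(m, n)) (F : V -> 'cV[R]_n) dF (x0 : V) :
  c11 F dF x0 -> c11 (fun x => M *m F x) (fun x d => M *m dF x d) x0.
Proof.
move=> HF; have [K _ HK] := mulmx_bounded M.
apply: (c11_comp (G := mulmx M) (dG := fun=> mulmx M) HF).
apply: c11_linear HK => a u v.
by rewrite mulmxDr -scalemxAr.
Qed.

Lemma c11_coord n (F : V -> 'cV[R]_n) dF (x0 : V) i :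
  c11 F dF x0 -> c11 (fun x => F x i 0) (fun x d => dF x d i 0) x0.
Proof.
move=> HF.
apply: (c11_comp (G := fun v : 'cV[R]_n => v i 0) (dG := fun _ v => v i 0) HF).
apply: (@c11_linear _ _ _ _ 1) => [a u v|d]; first by rewrite !mxE.
by rewrite mul1r mx_coord_le.
Qed.

End C11Matrix.

Section C11Point.
Variables (R : realType) (N : nat).
Local Notation point := (SN_point R N).

Lemma norm_point_le (b : point) (c : R) :
  (`|b| <= c) = [&& `|b.1.1.1| <= c, `|b.1.1.2| <= c, `|b.1.2| <= c & `|b.2| <= c].
Proof. by rewrite !norm_pair_le -!andbA. Qed.

Lemma point_coord_le (b : point) :
  [/\ `|b.1.1.1| <= `|b|, `|b.1.1.2| <= `|b|, `|b.1.2| <= `|b| & `|b.2| <= `|b|].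
Proof. by have := lexx `|b|; rewrite {1}norm_point_le => /and4P[]. Qed.

Lemma c11_eps (x0 : point) :
  c11 (fun b : point => b.1.1.1) (fun _ d => d.1.1.1) x0.
Proof.
apply: (@c11_linear _ _ _ _ 1) => // d.
by rewrite mul1r; case: (point_coord_le d).
Qed.

Lemma c11_C (x0 : point) :
  c11 (fun b : point => b.1.1.2) (fun _ d => d.1.1.2) x0.
Proof.
apply: (@c11_linear _ _ _ _ 1) => // d.
by rewrite mul1r; case: (point_coord_le d).
Qed.

Lemma c11_mu (x0 : point) : c11 (fun b : point => b.1.2) (fun _ d => d.1.2) x0.
Proof.
apply: (@c11_linear _ _ _ _ 1) => // d.
by rewrite mul1r; case: (point_coord_le d).
Qed.

Lemma c11_w (x0 : point) : c11 (fun b : point => b.2) (fun _ d => d.2) x0.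
Proof.
apply: (@c11_linear _ _ _ _ 1) => // d.
by rewrite mul1r; case: (point_coord_le d).
Qed.

End C11Point.

Section ScalarFunctions.
Variable R : realType.
Implicit Type t : R.

Lemma c11_expRN (t0 : R) :
  c11 (fun t : R => expR (- t)) (fun t d => - expR (- t) * d) t0.
Proof.
have H : c11 (fun t : R => - t) (fun _ d => - d) t0.
  apply: (@c11_linear _ _ _ _ 1) => [a u v|d]; last by rewrite normrN mul1r.
  by rewrite opprD scalerN.
apply: c11_eq (c11_comp H (c11_expR _)) => // t d.
by rewrite mulrN mulNr.
Qed.

Lemma c11_logistic (t0 : R) :
  c11 (fun t : R => (1 - expR (- t)) / (1 + expR (- t)))
    (fun t d => 2 * (2 + expR (- t) + expR t)^-1 * d) t0.
Proof.
have e0 (t : R) := expR_gt0 (- t).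
have H1 := c11D (c11_cst (1 : R) t0) (c11_expRN t0).
have p0 : 0 < 1 + expR (- t0) by rewrite addr_gt0.
have H2 := c11_comp H1 (c11_inv p0).
(* Writing the function as [2 / (1 + exp (- t)) - 1] leaves a single reciprocal to differentiate. *)
have H3 := c11D (c11Z (c11_cst (2 : R) t0) H2) (c11_cst (- 1 : R) t0).
apply: c11_eq H3 => [t|t d]; rewrite -![_ *: _]/(_ * _).
  have := e0 t; move: (expR (- t)) => e ep; field.
  by rewrite gt_eqF // addr_gt0.
have -> : expR t = (expR (- t))^-1 by rewrite expRN invrK.
have := e0 t; move: (expR (- t)) => e ep; field.
by rewrite !gt_eqF //= !addr_gt0 // ?mulr_gt0 // addr_gt0.
Qed.

(** The profile of [u_vec] has that of [q_vec] as derivative: this is the origin of the second term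
    of [alpha_mx]. *)
Lemma c11_logistic_deriv (t0 : R) :
  c11 (fun t : R => (2 + expR (- t) + expR t)^-1)
    (fun t d => expR (- t) * (expR (- t) - 1) / (1 + expR (- t)) ^+ 3 * d) t0.
Proof.
have H1 := c11D (c11D (c11_cst (2 : R) t0) (c11_expRN t0)) (c11_expR t0).
have p0 : 0 < 2 + expR (- t0) + expR t0 by rewrite !addr_gt0 ?expR_gt0.
apply: c11_eq (c11_comp H1 (c11_inv p0)) => // t d.
have -> : expR t = (expR (- t))^-1 by rewrite expRN invrK.
have := expR_gt0 (- t); move: (expR (- t)) => e ep; field.
by rewrite !gt_eqF //= !addr_gt0 // ?mulr_gt0 // addr_gt0.
Qed.

(** The function is the derivative of [ln (1 + exp (- t))], so its own derivative, the profile of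
    [p_vec], produces the Hessian of [f_obj]. *)
Lemma c11_softplus_deriv (t0 : R) :
  c11 (fun t : R => - (1 + expR t)^-1) (fun t d => expR t / (1 + expR t) ^+ 2 * d) t0.
Proof.
have H1 := c11D (c11_cst (1 : R) t0) (c11_expR t0).
have p0 : 0 < 1 + expR t0 by rewrite !addr_gt0 ?expR_gt0.
have H2 := c11Z (c11_cst (- 1 : R) t0) (c11_comp H1 (c11_inv p0)).
apply: c11_eq H2 => [t|t d]; rewrite -![_ *: _]/(_ * _); first by rewrite mulN1r.
have := expR_gt0 t; move: (expR t) => e ep; field.
by rewrite !gt_eqF //= addr_gt0.
Qed.

Lemma is_diff_softplus (t : R) :
  is_diff t (fun t : R => ln (1 + expR (- t))) (fun s => s *: (- (1 + expR t)^-1)).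
Proof.
have e0 := expR_gt0 (- t).
have p0 : 0 < 1 + expR (- t) by rewrite addr_gt0.
have H1 : is_derive t 1 (fun t : R => expR (- t)) (- expR (- t)).
  have := @is_derive1_comp R expR (fun t => - t) t (expR (- t)) (-1) _ _.
  by rewrite mulrN1; apply.
have H2 : is_derive t 1 (fun t : R => 1 + expR (- t)) (- expR (- t)).
  by rewrite -[X in is_derive _ _ _ X]add0r; apply: is_deriveD.
have H3 := is_derive1_ln p0.
have H : is_derive t 1 (fun t : R => ln (1 + expR (- t))) (- (1 + expR t)^-1).
  have H4 := @is_derive1_comp R (@ln R) (fun t : R => 1 + expR (- t)) t _ _ H3 H2.
  apply: (is_derive_eq H4).
  have -> : expR t = (expR (- t))^-1 by rewrite expRN invrK.
  move: (expR (- t)) e0 {p0 H1 H2 H3} => e ep; field.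
  by rewrite !gt_eqF //= addr_gt0.
apply: DiffDef; first by apply/derivable1_diffP; apply: ex_derive.
rewrite diff1E; last by apply/derivable1_diffP; apply: ex_derive.
by rewrite derive1E (@derive_val _ _ _ _ _ _ _ H).
Qed.

End ScalarFunctions.

(** [gradient] is assembled from directional derivatives; this closed form is what the [c11]
    calculus can differentiate once more. *)
Lemma gradient_f_obj (R : realType) (M1 N : nat) (A : 'M[R]_(M1, N)) (w : 'cV[R]_N) :
  gradient (f_obj A) w = A^T *m \col_j (- (1 + expR ((A *m w) j 0))^-1).
Proof.
pose ph (t : R) := ln (1 + expR (- t)).
pose th (k : 'I_M1) := \sum_i A k i *: (fun v : 'cV[R]_N => v i 0).
have thE k v : th k v = (A *m v) k 0.
  by rewrite /th fct_sumE mxE; apply: eq_bigr => i _.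
have dth k v : is_diff v (th k) (th k).
  by apply: is_diff_sum => i; apply: is_diffZ; exact: is_diff_coord.
have HF k := @is_diff_comp _ _ _ _ (th k) (th k) ph _ w (dth k w)
    (is_diff_softplus (th k w)).
have H := is_diff_sum HF.
have fE : f_obj A = \sum_k (ph \o th k).
  by rewrite funeqE => v; rewrite fct_sumE; apply: eq_bigr => k _; rewrite /= thE.
apply/colP => i; rewrite [LHS]mxE.
have df : differentiable (f_obj A) w by rewrite fE; exact: ex_diff.
rewrite (deriveE _ df) fE (diff_val (is_diff_def := H)) fct_sumE mxE.
apply: eq_bigr => k _; rewrite /= !thE -![_ *: _]/(_ * _) !mxE.
congr (_ * _); rewrite (bigD1 i) //= big1 ?addr0.
  by rewrite !mxE !eqxx mulr1.
by move=> j ji; rewrite !mxE (negbTE ji) mulr0.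
Qed.

(** * The Huber function for a positive smoothing parameter *)

Section HuberSmoothing.
Variable R : realType.
Implicit Types e t : R.

(** [huber_dt] and [huber_de] are the partial derivatives of the closed form in [huberE], free of
    case distinctions; they are meaningful for [e > 0]. *)
Definition huber_dt (e t : R) : R := (Num.max 0 t - Num.max 0 (t - e)) / e.

Definition huber_de (e t : R) : R :=
  Num.max 0 (t - e) / e - (Num.max 0 t ^+ 2 - Num.max 0 (t - e) ^+ 2) / (2 * e ^+ 2).

(** For [e > 0] the Huber function is the mean of the positive part over the interval from [t - e]
    to [t]. *)
Lemma huberE e t : 0 < e ->
  huber e t = (Num.max 0 t ^+ 2 - Num.max 0 (t - e) ^+ 2) / (2 * e).
Proof.
move=> e0; rewrite /huber gt_eqF // gtr0_norm //.
have [te|te] := ltP e t.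
  by rewrite !max_r; [field; rewrite gt_eqF|lra|lra].
rewrite (max_l (_ : t - e <= 0)); last by lra.
by have [t0|t0] := leP 0 t; rewrite expr0n /= subr0 // mul0r.
Qed.

(** The positive part is nondecreasing and 1-Lipschitz, and [huber_dt] is its difference quotient
    over a step [e]. *)
Lemma huber_dt_itv e t : 0 < e -> 0 <= huber_dt e t <= 1.
Proof.
move=> e0; rewrite /huber_dt.
rewrite ler_pdivlMr // ler_pdivrMr // mul0r mul1r.
by have [h1|h1] := leP 0 t; have [h2|h2] := leP 0 (t - e); apply/andP; split; lra.
Qed.

Lemma huber_de_itv e t : 0 < e -> -1 <= huber_de e t <= 0.
Proof.
move=> e0; rewrite /huber_de.
have -> : forall a c : R, a / e - c / (2 * e ^+ 2) = (2 * e * a - c) / (2 * e ^+ 2).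
  by move=> a c; field; rewrite gt_eqF.
rewrite ler_pdivlMr ?ler_pdivrMr ?mulr_gt0 ?exprn_gt0 //.
have := sqr_ge0 e; have := sqr_ge0 t; have := sqr_ge0 (t - e).
by have [h1|h1] := leP 0 t; have [h2|h2] := leP 0 (t - e); move=> *; apply/andP; split; nra.
Qed.

Lemma c11_huber (V : normedModType R) (e t : V -> R) de dt (x0 : V) :
  c11 e de x0 -> c11 t dt x0 -> 0 < e x0 ->
  c11 (fun x => huber (e x) (t x))
    (fun x d => huber_de (e x) (t x) * de x d + huber_dt (e x) (t x) * dt x d) x0.
Proof.
move=> He Ht e0.
have H1 := c11_comp Ht (c11_sqr_pos_part (t x0)).
have H2 := c11D Ht (c11Z (c11_cst (- 1 : R) x0) He).
have H3 := c11_comp H2 (c11_sqr_pos_part _).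
have H4 := c11D H1 (c11Z (c11_cst (- 1 : R) x0) H3).
have H5 := c11Z (c11_cst (2^-1 : R) x0) (c11_comp He (c11_inv e0)).
have [r [K [r0 _ K1 [_ _ lip]]]] := c11_bounded He.
have K0 : 0 < K by lra.
(* On this radius the Lipschitz bound changes [e] by less than [e x0], so it stays positive and
   [huberE] applies. *)
have e_gt0 x : `|x - x0| < Num.min r (e x0 / K) -> 0 < e x.
  rewrite lt_min => /andP[xr xe].
  have := lip x0 x; rewrite subrr normr0 => /(_ r0 xr).
  rewrite ltr_pdivlMr // mulrC in xe; rewrite ler_norml => /andP[]; lra.
apply: (c11_eq_near (s := Num.min r (e x0 / K))) (c11Z H5 H4).
- by rewrite lt_min r0 divr_gt0.
- move=> x /e_gt0 ex0; rewrite -![_ *: _]/(_ * _) !mulN1r.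
  by rewrite huberE //; field; rewrite gt_eqF.
- move=> x d /e_gt0 ex0; rewrite -![_ *: _]/(_ * _) !mulN1r /huber_de /huber_dt.
  move: (Num.max _ _) (Num.max _ _) => p q.
  by field; rewrite gt_eqF.
Qed.

(* On [e > 0], [huber] is positively homogeneous of degree 1 near its kink at
   [(0, 0)] and affine near [(0, ts)] with [ts != 0]. *)
Lemma huber_euler (ts : R) : exists2 r : R, 0 < r & forall e t,
  0 < e -> e < r -> `|t - ts| < r ->
  huber e t - huber_de e t * e + huber_dt e t * (ts - t) = huber 0 ts.
Proof.
have -> : huber 0 ts = Num.max 0 ts by rewrite /huber eqxx.
(* Euler's identity for degree 1 reduces the left-hand side to [huber_dt e t * ts], so only the
   slope has to be identified, and only when [ts] is nonzero. *)
have E e t : 0 < e -> huber e t - huber_de e t * e - huber_dt e t * t = 0.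
  move=> e0; rewrite huberE // /huber_de /huber_dt.
  by have [h1|h1] := leP 0 t; have [h2|h2] := leP 0 (t - e); field; rewrite gt_eqF.
have [ts0|ts0|->] := ltgtP ts 0.
- exists (- ts / 2) => [|e t e0 er]; first by lra.
  rewrite ltr_norml => /andP[t1 t2].
  have : huber_dt e t = 0.
    by rewrite /huber_dt !max_l; [rewrite subrr mul0r|lra|lra].
  have := E e t e0 => + dt0; rewrite dt0 mul0r subr0 mul0r addr0 => ->.
  by [].
(* Within [ts / 3] one has [t > 2 ts / 3] and [e < ts / 3], hence [t > e]: the affine branch, of
   slope 1. *)
- exists (ts / 3) => [|e t e0 er]; first by lra.
  rewrite ltr_norml => /andP[t1 t2].
  have dt1 : huber_dt e t = 1.
    rewrite /huber_dt !max_r; [|lra|lra].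
    by field; rewrite gt_eqF.
  have := E e t e0; rewrite dt1; lra.
- exists 1 => // e t e0 _ _; have := E e t e0.
  by rewrite sub0r mulrN.
Qed.

End HuberSmoothing.

Lemma dot_colE (R : realType) (n : nat) (u v : 'cV[R]_n) :
  (u^T *m v) 0 0 = \sum_i u i 0 * v i 0.
Proof. by rewrite mxE; apply: eq_bigr => i _; rewrite mxE. Qed.

(** * The map [E] and its Jacobian for positive [eps] *)

Section KKTMap.
Variables (R : realType) (M1 N M2 : nat) (A : 'M[R]_(M1, N)) (X : 'M[R]_(N, M2)).
Variables (y : 'cV[R]_M2) (kappa : R).
Local Notation point := (SN_point R N).
Implicit Types b d : point.

(** [slack], [stationarity] and [lower_level] are smooth across [eps = 0]; isolating them confines
    the nonsmoothness to the Huber function and [|eps|]. *)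
Definition slack b : R := b.1.1.2 - (b.1.2^T *m g_map X y b.2) 0 0.

Definition dslack b d : R := d.1.1.2 -
  ((d.1.2^T *m g_map X y b.2) 0 0 + (b.1.2^T *m (nabla_g X b.2 *m d.2)) 0 0).

Definition stationarity b : 'cV[R]_N :=
  M1%:R^-1 *: gradient (f_obj A) b.2 + P_mx X b.1.1.2 b.2 *m b.1.2.

(** [alpha_mx] is the partial Jacobian in [w]: the scaled Hessian of [f_obj] plus the derivative of
    [C (nabla_g w) mu] with [mu] held fixed. *)
Definition dstationarity b d : 'cV[R]_N :=
  alpha_mx A X b.1.1.2 b.1.2 b.2 *m d.2 + d.1.1.2 *: (nabla_g X b.2 *m b.1.2)
  + P_mx X b.1.1.2 b.2 *m d.1.2.

Definition lower_level b : 'cV[R]_N := b.2 + b.1.1.2 *: g_map X y b.2.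

Definition dlower_level b d : 'cV[R]_N :=
  P_mx X b.1.1.2 b.2 *m d.2 + d.1.1.2 *: g_map X y b.2.

Lemma c11_g (b0 : point) :
  c11 (fun b : point => g_map X y b.2) (fun b d => nabla_g X b.2 *m d.2) b0.
Proof.
have Hk k := c11_comp (c11_coord k (c11_mulmx X^T (c11_w b0))) (c11_logistic _).
have H1 := c11D (c11_col Hk) (c11_cst (- y) b0).
have H2 := c11Z (c11_cst (2^-1 : R) b0) (c11_mulmx X H1).
apply: c11_eq H2 => [b|b d].
  suff -> : \col_k ((1 - expR (- (X^T *m b.2) k 0)) / (1 + expR (- (X^T *m b.2) k 0))) =
    h_vec X b.2 by [].
  by apply/colP => k; rewrite !mxE.
rewrite scale0r addr0 addr0 /nabla_g -!mulmxA scalemxAr; congr (_ *m _).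
apply/colP => k; rewrite /Diag mul_diag_mx !mxE.
by field; rewrite gt_eqF // !addr_gt0 ?expR_gt0.
Qed.

Lemma c11_slack (b0 : point) : c11 slack dslack b0.
Proof.
have Hi i := c11Z (c11_coord i (c11_mu b0)) (c11_coord i (c11_g b0)).
have H := c11D (c11_C b0)
  (c11Z (c11_cst (- 1 : R) b0) (c11_sum (index_enum 'I_N) Hi)).
apply: c11_eq H => [b|b d]; rewrite -![_ *: _]/(_ * _) ?mul0r ?addr0 mulN1r.
  by rewrite /slack dot_colE.
rewrite /dslack !dot_colE -big_split /=; congr (_ - _).
by apply: eq_bigr => i _; rewrite addrC.
Qed.

Lemma nabla_g_mulE (w v : 'cV[R]_N) : nabla_g X w *m v =
  X *m \col_k ((2 + expR (- (X^T *m w) k 0) + expR ((X^T *m w) k 0))^-1 *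
                (X^T *m v) k 0).
Proof.
rewrite /nabla_g -!mulmxA; congr (_ *m _).
by apply/colP => k; rewrite /Diag mul_diag_mx !mxE.
Qed.

Lemma c11_stationarity (b0 : point) : c11 stationarity dstationarity b0.
Proof.
have Hj j := c11_comp (c11_coord j (c11_mulmx A (c11_w b0))) (c11_softplus_deriv _).
have H1 := c11Z (c11_cst (M1%:R^-1 : R) b0) (c11_mulmx A^T (c11_col Hj)).
have Hu k := c11_comp (c11_coord k (c11_mulmx X^T (c11_w b0))) (c11_logistic_deriv _).
have Hk k := c11Z (Hu k) (c11_coord k (c11_mulmx X^T (c11_mu b0))).
have H2 := c11D (c11_mu b0) (c11Z (c11_C b0) (c11_mulmx X (c11_col Hk))).
apply: c11_eq (c11D H1 H2) => [b|b d].
  rewrite /stationarity gradient_f_obj /P_mx mulmxDl mul1mx -scalemxAl.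
  by rewrite nabla_g_mulE.
rewrite /dstationarity /P_mx /alpha_mx !mulmxDl mul1mx -!scalemxAl.
have -> : A^T *m Diag (p_vec A b.2) *m A *m d.2 =
    A^T *m (\col_j (expR ((A *m b.2) j 0) / (1 + expR ((A *m b.2) j 0)) ^+ 2 *
              (A *m d.2) j 0)).
  rewrite -!mulmxA; congr (_ *m _).
  by apply/colP => k; rewrite /Diag mul_diag_mx !mxE.
set Q := X *m Diag _ *m _ *m _ *m _.
rewrite !nabla_g_mulE scale0r addr0.
set U := \col_i (_ + _).
have -> : X *m U = X *m (\col_k ((2 + expR (- (X^T *m b.2) k 0) +
    expR ((X^T *m b.2) k 0))^-1 * (X^T *m d.1.2) k 0)) + Q.
  rewrite /Q -!mulmxA -mulmxDr; congr (_ *m _).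
  apply/colP => k; rewrite /Diag !mul_diag_mx !mxE.
  by rewrite -![_ *: _]/(_ * _); congr (_ + _); rewrite mulrC.
rewrite scalerDr !addrA; rewrite [LHS](ACl (1*4*5*2*3)) /=.
by [].
Qed.

Lemma c11_lower_level (b0 : point) : c11 lower_level dlower_level b0.
Proof.
have H := c11D (c11_w b0) (c11Z (c11_C b0) (c11_g b0)).
apply: c11_eq H => [//|b d].
by rewrite /dlower_level /P_mx mulmxDl mul1mx -scalemxAl addrA.
Qed.

(* [s] and [e] stand for the partial derivatives of the smoothing function: at
   [eps = 0] they range over a whole interval. *)
Definition jacobian_with (s e : R) b d : SN_residual R N :=
  (kappa * d.1.1.1 * b.1.1.2 + (1 + kappa * b.1.1.1) * d.1.1.2
     - (e * d.1.1.1 + s * dslack b d),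
   dstationarity b d, dlower_level b d).

Definition dE_map b d : SN_residual R N :=
  jacobian_with (huber_dt b.1.1.1 (slack b)) (huber_de b.1.1.1 (slack b)) b d.

Local Notation E := (E_map A X y kappa).

Lemma E_mapE b : 0 <= b.1.1.1 -> E b =
  ((1 + kappa * b.1.1.1) * b.1.1.2 - huber b.1.1.1 (slack b),
   stationarity b, lower_level b).
Proof. by case: b => [[[e C] mu] w] /= e0; rewrite ger0_norm. Qed.

Lemma c11_E_map (b0 : point) : 0 < b0.1.1.1 -> c11 E dE_map b0.
Proof.
move=> e0.
have H0 := c11D (c11_cst (1 : R) b0) (c11Z (c11_cst (kappa : R) b0) (c11_eps b0)).
have H1 := c11Z H0 (c11_C b0).
have H2 := c11_huber (c11_eps b0) (c11_slack b0) e0.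
have H3 := c11D H1 (c11Z (c11_cst (- 1 : R) b0) H2).
have H4 := c11_pair (c11_pair H3 (c11_stationarity b0)) (c11_lower_level b0).
apply: (c11_eq_near (s := b0.1.1.1)) H4 => // [b|b d].
  move=> bb0; rewrite E_mapE.
    by congr (_, _, _); rewrite -![_ *: _]/(_ * _) mulN1r.
  have [+ _ _ _] := point_coord_le (b - b0) => /= h.
  have := le_lt_trans h bb0; rewrite ltr_norml => /andP[]; lra.
move=> _; rewrite /dE_map /jacobian_with; congr (_, _, _).
by rewrite -![_ *: _]/(_ * _); ring.
Qed.

End KKTMap.

(** * Uniform invertibility of the Jacobian *)

Section JacobianAtSolution.
Variables (R : realType) (N : nat).
Implicit Types (u v : 'cV[R]_N).

Local Notation dot u v := ((u^T *m v) 0 0).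

Lemma dotC u v : dot u v = dot v u.
Proof. by rewrite !dot_colE; apply: eq_bigr => i _; rewrite mulrC. Qed.

Lemma dotBr u v v' : dot u (v - v') = dot u v - dot u v'.
Proof. by rewrite mulmxBr !mxE. Qed.

Lemma dotZr a u v : dot u (a *: v) = a * dot u v.
Proof. by rewrite -scalemxAr mxE. Qed.

Lemma dot_bounded u : exists2 K : R, 0 <= K & forall v, `|dot u v| <= K * `|v|.
Proof.
have [K K0 HK] := mulmx_bounded u^T.
by exists K => // v; apply: le_trans (HK v); exact: mx_coord_le.
Qed.

(* Eliminating [dw] and then [dmu] leaves [(c - s + s z) dC], and
   [c - s + s z >= min 1 z > 0]. *)
Lemma kkt_system_bounded_below (P G al : 'M[R]_N) (g mu : 'cV[R]_N) :
  P \in unitmx -> P^T = P -> G^T = G ->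
  0 < (g^T *m invmx P *m (al *m invmx P *m g - 2 *: (G *m mu))) 0 0 ->
  exists2 K : R, 0 <= K & forall (s c dC : R) (dmu dw : 'cV[R]_N),
    0 <= s <= 1 -> 1 <= c ->
    let S := `|c * dC - s * (dC - (dot dmu g + dot mu (G *m dw)))|
             + `|al *m dw + dC *: (G *m mu) + P *m dmu| + `|P *m dw + dC *: g| in
    [/\ `|dC| <= K * S, `|dmu| <= K * S & `|dw| <= K * S].
Proof.
move=> Pu PT GT z0; set Q := invmx P in z0 *.
have QT : Q^T = Q by rewrite /Q trmx_inv PT.
set z := (X in 0 < X) in z0.
have zE : z = dot g (Q *m (al *m (Q *m g))) - 2 * dot g (Q *m (G *m mu)).
  by rewrite /z -!mulmxA mulmxBr -scalemxAr dotBr dotZr.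
set m := Num.min 1 z.
have m0 : 0 < m by rewrite lt_min ltr01.
have [k1 k10 Hk1] := mulmx_bounded Q.
have [k2 k20 Hk2] := mulmx_bounded al.
have [k3 k30 Hk3] := dot_bounded g.
have [k4 k40 Hk4] := dot_bounded (G *m mu).
(* The constants follow the back-substitution: [KC] bounds [dC] through the reduced scalar equation,
   then [Kw] bounds [dw] and [Km] bounds [dmu]. *)
pose KC := m^-1 * (1 + k3 * k1 + k3 * (k1 * (k2 * k1)) + k4 * k1).
pose Kw := k1 * (1 + KC * `|g|).
pose Km := k1 * (1 + k2 * Kw + KC * `|G *m mu|).
have KC0 : 0 <= KC by rewrite mulr_ge0 ?invr_ge0 ?(ltW m0) // !addr_ge0 // !mulr_ge0.
have Kw0 : 0 <= Kw by rewrite mulr_ge0 // addr_ge0 // mulr_ge0.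
have Km0 : 0 <= Km by rewrite mulr_ge0 // !addr_ge0 // mulr_ge0.
exists (KC + Kw + Km) => [|s c dC dmu dw /andP[s0 s1] c1]; first by rewrite !addr_ge0.
set r1 := c * dC - _; set r2 := _ + P *m dmu; set r3 := P *m dw + _.
move=> S.
have n1 := normr_ge0 r1; have n2 := normr_ge0 r2; have n3 := normr_ge0 r3.
have S0 : 0 <= S by rewrite !addr_ge0.
have dwE : dw = Q *m r3 - dC *: (Q *m g).
  by rewrite mulmxDr mulKmx // -scalemxAr addrK.
have dmuE : dmu = Q *m r2 - Q *m (al *m dw) - dC *: (Q *m (G *m mu)).
  rewrite !mulmxDr mulKmx // -scalemxAr.
  by rewrite -[RHS]addrA -opprD [RHS]addrAC subrr add0r.
(* Symmetry of [P] and [G] identifies the product of [G mu] with [Q g] and that of [g] with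
   [Q G mu]. The two equal terms, one from [dw] and one from [dmu], make up the factor 2 in [z]. *)
have r1E : r1 = (c - s + s * z) * dC + s * (dot g (Q *m r2)
    - dot g (Q *m (al *m (Q *m r3))) + dot (G *m mu) (Q *m r3)).
  have -> : r1 = c * dC - s * (dC - (dot g dmu + dot (G *m mu) dw)).
    by rewrite /r1 (dotC dmu) trmx_mul GT mulmxA.
  have -> : dot (G *m mu) dw = dot (G *m mu) (Q *m r3) - dC * dot g (Q *m (G *m mu)).
    rewrite {1}dwE dotBr dotZr; congr (_ - _ * _).
    by rewrite dotC [in RHS]mulmxA -{2}QT -trmx_mul.
  have -> : dot g dmu = dot g (Q *m r2) - (dot g (Q *m (al *m (Q *m r3)))
      - dC * dot g (Q *m (al *m (Q *m g)))) - dC * dot g (Q *m (G *m mu)).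
    rewrite {1}dmuE !dotBr dotZr {1}dwE mulmxBr -scalemxAr mulmxBr -scalemxAr.
    by rewrite dotBr dotZr.
  by rewrite zE; ring.
(* Since [c >= 1], the coefficient is at least [(1 - s) * 1 + s * z], a convex combination of 1 and
   [z]. *)
have coef : m <= c - s + s * z.
  have m1 : m <= 1 by rewrite ge_min lexx.
  have mz : m <= z by rewrite ge_min lexx orbT.
  nra.
have Q3 : `|Q *m r3| <= k1 * S by apply: le_trans (Hk1 _) _; rewrite ler_wpM2l // /S; lra.
have Q2 : `|Q *m r2| <= k1 * S by apply: le_trans (Hk1 _) _; rewrite ler_wpM2l // /S; lra.
have HC : `|dC| <= KC * S.
  have : m * `|dC| <= `|r1| + `|dot g (Q *m r2)
    - dot g (Q *m (al *m (Q *m r3))) + dot (G *m mu) (Q *m r3)|.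
    apply: (@le_trans _ _ `|(c - s + s * z) * dC|).
      rewrite normrM ler_wpM2r // ger0_norm //; apply: le_trans coef; exact: ltW.
    rewrite -[X in `|X|](addrK (s * (dot g (Q *m r2)
      - dot g (Q *m (al *m (Q *m r3))) + dot (G *m mu) (Q *m r3)))) -r1E.
    apply: le_trans (ler_normB _ _) _; rewrite lerD2l normrM ler_piMl //.
    by rewrite ger0_norm.
  rewrite -ler_pdivlMl // => H; apply: le_trans H _.
  rewrite /KC -[leRHS]mulrA ler_wpM2l ?invr_ge0 ?(ltW m0) //.
  have a1 : `|dot g (Q *m r2)| <= k3 * (k1 * S).
    by apply: le_trans (Hk3 _) _; rewrite ler_wpM2l.
  have a2 : `|dot g (Q *m (al *m (Q *m r3)))| <= k3 * (k1 * (k2 * (k1 * S))).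
    apply: le_trans (Hk3 _) _; rewrite ler_wpM2l //.
    apply: le_trans (Hk1 _) _; rewrite ler_wpM2l //.
    by apply: le_trans (Hk2 _) _; rewrite ler_wpM2l.
  have a3 : `|dot (G *m mu) (Q *m r3)| <= k4 * (k1 * S).
    by apply: le_trans (Hk4 _) _; rewrite ler_wpM2l.
  have := ler_normD (dot g (Q *m r2) - dot g (Q *m (al *m (Q *m r3)))) (dot (G *m mu) (Q *m r3)).
  have := ler_normB (dot g (Q *m r2)) (dot g (Q *m (al *m (Q *m r3)))).
  have : `|r1| <= S by rewrite /S; lra.
  have -> : (1 + k3 * k1 + k3 * (k1 * (k2 * k1)) + k4 * k1) * S =
    S + k3 * (k1 * S) + k3 * (k1 * (k2 * (k1 * S))) + k4 * (k1 * S) by ring.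
  lra.
have Hw : `|dw| <= Kw * S.
  rewrite dwE scalemxAr -mulmxBr; apply: le_trans (Hk1 _) _.
  rewrite /Kw -[leRHS]mulrA ler_wpM2l //; apply: le_trans (ler_normB _ _) _.
  rewrite normrZ mulrDl mul1r mulrAC; apply: lerD; first by rewrite /S; lra.
  by rewrite ler_wpM2r.
have Hm : `|dmu| <= Km * S.
  rewrite dmuE scalemxAr -!mulmxBr; apply: le_trans (Hk1 _) _.
  rewrite /Km -[leRHS]mulrA ler_wpM2l //; apply: le_trans (ler_normB _ _) _.
  rewrite normrZ !mulrDl mul1r; apply: lerD; last by rewrite mulrAC ler_wpM2r.
  apply: le_trans (ler_normB _ _) _; apply: lerD; first by rewrite /S; lra.
  by apply: le_trans (Hk2 _) _; rewrite -mulrA ler_wpM2l.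
have S1 : KC * S <= (KC + Kw + Km) * S by rewrite ler_wpM2r //; lra.
have S2 : Km * S <= (KC + Kw + Km) * S by rewrite ler_wpM2r //; lra.
have S3 : Kw * S <= (KC + Kw + Km) * S by rewrite ler_wpM2r //; lra.
by split; [apply: le_trans S1|apply: le_trans S2|apply: le_trans S3].
Qed.

End JacobianAtSolution.

(** * Estimates near a point, uniform in the Huber partials *)

Section LocalEstimates.
Variables (R : realType) (M1 N M2 : nat) (A : 'M[R]_(M1, N)) (X : 'M[R]_(N, M2)).
Variables (y : 'cV[R]_M2) (kappa : R).
Hypothesis kappa_gt0 : 0 < kappa.
Local Notation point := (SN_point R N).
Local Notation E := (E_map A X y kappa).
Local Notation dE := (dE_map A X y kappa).
Local Notation J := (jacobian_with A X y kappa).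
Implicit Types b d : point.

Lemma nabla_g_sym (w : 'cV[R]_N) : (nabla_g X w)^T = nabla_g X w.
Proof. by rewrite /nabla_g !trmx_mul trmxK /Diag tr_diag_mx mulmxA. Qed.

Lemma P_mx_sym (C : R) (w : 'cV[R]_N) : (P_mx X C w)^T = P_mx X C w.
Proof. by rewrite /P_mx linearD /= trmx1 linearZ /= nabla_g_sym. Qed.

Lemma norm_residual_le (e : SN_residual R N) (c : R) :
  (`|e| <= c) = [&& `|e.1.1| <= c, `|e.1.2| <= c & `|e.2| <= c].
Proof. by rewrite !norm_pair_le -!andbA. Qed.

Lemma residual_coord_le (e : SN_residual R N) :
  [/\ `|e.1.1| <= `|e|, `|e.1.2| <= `|e| & `|e.2| <= `|e|].
Proof. by have := lexx `|e|; rewrite {1}norm_residual_le => /and3P[]. Qed.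

(** The terms of the first row containing [d eps] move to the right-hand side, where [|d eps|]
    controls them. What is left is the KKT system with [c = 1 + kappa eps >= 1]. *)
Lemma jacobian_with_bounded_below (bs : point) :
  z_positive A X y bs -> 0 <= bs.1.1.1 ->
  exists2 K : R, 0 <= K & forall s e d, 0 <= s <= 1 -> `|e| <= 1 ->
    `|d| <= K * (`|d.1.1.1| + `|J s e bs d|).
Proof.
case: bs => [[[es Cs] mus] ws] [Pu z0] /= es0.
have [K K0 HK] := kkt_system_bounded_below Pu (P_mx_sym _ _) (nabla_g_sym _) z0.
(* The 3 counts the residual blocks; [kappa |Cs| + 1] bounds the coefficient of [d eps] moved to the
   right. *)
pose K2 := 3 + kappa * `|Cs| + 1.
have K20 : 0 <= kappa * `|Cs| by rewrite mulr_ge0 // ltW.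
exists (1 + K * K2) => [|s e [[[de dC] dmu] dw] s01 e1 /=].
  by rewrite addr_ge0 // mulr_ge0 // /K2; lra.
set Jd := J _ _ _ _.
have [/= J1 J2 J3] := residual_coord_le Jd.
have c1 : 1 <= 1 + kappa * es by rewrite lerDl mulr_ge0 // ltW.
have := HK s (1 + kappa * es) dC dmu dw s01 c1; cbv zeta.
set r1 := (X in `|X| + _ + _).
set r2 := (X in _ + `|X| + _).
set r3 := (X in _ + _ + `|X|).
have r1E : r1 = Jd.1.1 - kappa * de * Cs + e * de.
  by rewrite /Jd /jacobian_with /dslack /= /r1; ring.
have h1 : `|r1| <= `|Jd| + (kappa * `|Cs| + 1) * `|de|.
  rewrite r1E; apply: le_trans (ler_normD _ _) _.
  have := ler_normB Jd.1.1 (kappa * de * Cs).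
  have -> : `|kappa * de * Cs| = kappa * `|Cs| * `|de|.
    by rewrite !normrM (gtr0_norm kappa_gt0) mulrAC.
  have : `|e * de| <= `|de| by rewrite normrM ler_piMl.
  lra.
have n0 := normr_ge0 de; have n1 := normr_ge0 Jd.
have hS : `|r1| + `|r2| + `|r3| <= K2 * (`|de| + `|Jd|).
  have : 0 <= kappa * `|Cs| * `|Jd| by rewrite mulr_ge0.
  have : 0 <= kappa * `|Cs| * `|de| by rewrite mulr_ge0.
  have J2' : `|r2| <= `|Jd| := J2.
  have J3' : `|r3| <= `|Jd| := J3.
  rewrite /K2; nra.
have hK : K * (`|r1| + `|r2| + `|r3|) <= (1 + K * K2) * (`|de| + `|Jd|).
  rewrite mulrDl mul1r; apply: ler_wpDl; first by rewrite addr_ge0.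
  by rewrite -mulrA ler_wpM2l.
move=> [a1 a2 a3]; rewrite norm_point_le /=.
apply/and4P; split; [|exact: le_trans hK|exact: le_trans hK|exact: le_trans hK].
have K2' : 0 <= K2 by rewrite /K2; lra.
have := mulr_ge0 K0 K2'; nra.
Qed.

(** Keeping [s] and [e] the same at both points removes the only discontinuous data; the rest is a
    sum of a bilinear expression and Lipschitz derivatives. *)
Lemma jacobian_with_lipschitz (bs : point) :
  exists r K, [/\ 0 < r, 0 <= K & forall s e b d, 0 <= s <= 1 ->
    `|b - bs| < r -> `|J s e b d - J s e bs d| <= K * `|b - bs| * `|d|].
Proof.
have [r1 [K1 [r10 K10 H1]]] := c11_derivative_lipschitz (c11_slack X y bs).
have [r2 [K2 [r20 K20 H2]]] := c11_derivative_lipschitz (c11_stationarity A X bs).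
have [r3 [K3 [r30 K30 H3]]] := c11_derivative_lipschitz (c11_lower_level X y bs).
exists (Num.min r1 (Num.min r2 r3)), (2 * kappa + K1 + K2 + K3); split.
- by rewrite !lt_min r10 r20 r30.
- by rewrite !addr_ge0 // mulr_ge0 // ltW.
move=> s e b d /andP[s0 s1]; rewrite !lt_min => /and3P[br1 br2 br3].
have {}H1 := H1 b d br1; have {}H2 := H2 b d br2; have {}H3 := H3 b d br3.
set t := `|b - bs| * `|d|.
have t0 : 0 <= t by rewrite mulr_ge0.
rewrite -!mulrA -/t in H1 H2 H3 *.
have k1 : 0 <= K1 * t by rewrite mulr_ge0.
have k2 : 0 <= K2 * t by rewrite mulr_ge0.
have k3 : 0 <= K3 * t by rewrite mulr_ge0.
have k4 : 0 <= kappa * t by rewrite mulr_ge0 // ltW.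
have sumE : (2 * kappa + K1 + K2 + K3) * t = 2 * (kappa * t) + K1 * t + K2 * t + K3 * t.
  by ring.
rewrite norm_residual_le sumE; apply/and3P; split; first last.
- by apply: le_trans H3 _; lra.
- by apply: le_trans H2 _; lra.
have [/= b1 b2 _ _] := point_coord_le (b - bs).
have [/= d1 d2 _ _] := point_coord_le d.
have alg (de Cb Cs eb es dC D Ds : R) :
    kappa * (de * (Cb - Cs)) + kappa * ((eb - es) * dC) - s * (D - Ds) =
    kappa * de * Cb + (1 + kappa * eb) * dC - (e * de + s * D)
    - (kappa * de * Cs + (1 + kappa * es) * dC - (e * de + s * Ds)) by ring.
suff : `|kappa * (d.1.1.1 * (b.1.1.2 - bs.1.1.2)) + kappa * ((b.1.1.1 - bs.1.1.1) * d.1.1.2)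
    - s * (dslack X y b d - dslack X y bs d)|
    <= 2 * (kappa * t) + K1 * t + K2 * t + K3 * t by rewrite alg.
apply: le_trans (ler_normB _ _) _.
have m1 : `|kappa * (d.1.1.1 * (b.1.1.2 - bs.1.1.2))| <= kappa * t.
  rewrite normrM (gtr0_norm kappa_gt0) ler_wpM2l ?(ltW kappa_gt0) // normrM /t.
  by rewrite mulrC ler_pM.
have m2 : `|kappa * ((b.1.1.1 - bs.1.1.1) * d.1.1.2)| <= kappa * t.
  rewrite normrM (gtr0_norm kappa_gt0) ler_wpM2l ?(ltW kappa_gt0) // normrM /t.
  by rewrite ler_pM.
have m3 : `|s * (dslack X y b d - dslack X y bs d)| <= K1 * t.
  by rewrite normrM ger0_norm //; apply: le_trans H1; rewrite ler_piMl.
have := ler_normD (kappa * (d.1.1.1 * (b.1.1.2 - bs.1.1.2)))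
  (kappa * ((b.1.1.1 - bs.1.1.1) * d.1.1.2)).
lra.
Qed.

Lemma jacobian_with_bounded (bs : point) :
  exists2 K : R, 0 <= K & forall s e d, 0 <= s <= 1 -> `|e| <= 1 ->
    `|J s e bs d| <= K * `|d|.
Proof.
have [r1 [K1 [r10 K10 H1]]] := c11_slack X y bs.
have [r2 [K2 [r20 K20 H2]]] := c11_stationarity A X bs.
have [r3 [K3 [r30 K30 H3]]] := c11_lower_level X y bs.
have bb r : 0 < r -> `|bs - bs| < r by rewrite subrr normr0.
have [_ {}H1 _] := H1 _ (bb _ r10).
have [_ {}H2 _] := H2 _ (bb _ r20).
have [_ {}H3 _] := H3 _ (bb _ r30).
pose K4 := kappa * `|bs.1.1.2| + `|1 + kappa * bs.1.1.1| + 1.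
have K40 : 0 <= K4 by rewrite !addr_ge0 // mulr_ge0 // ltW.
exists (K4 + K1 + K2 + K3) => [|s e d /andP[s0 s1] e1].
  by rewrite addr_ge0 // addr_ge0 // addr_ge0.
have {}H1 := H1 d; have {}H2 := H2 d; have {}H3 := H3 d.
have k1 : 0 <= K1 * `|d| by rewrite mulr_ge0.
have k2 : 0 <= K2 * `|d| by rewrite mulr_ge0.
have k3 : 0 <= K3 * `|d| by rewrite mulr_ge0.
have k4 : 0 <= K4 * `|d| by rewrite mulr_ge0.
have sumE : (K4 + K1 + K2 + K3) * `|d| = K4 * `|d| + K1 * `|d| + K2 * `|d| + K3 * `|d|.
  by rewrite -!mulrDl.
rewrite norm_residual_le sumE; apply/and3P; split; first last.
- by apply: le_trans H3 _; lra.
- by apply: le_trans H2 _; lra.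
have [/= d1 d2 _ _] := point_coord_le d.
rewrite /jacobian_with /=.
apply: le_trans (ler_normB _ _) _.
have m1 : `|kappa * d.1.1.1 * bs.1.1.2| <= kappa * `|bs.1.1.2| * `|d|.
  rewrite !normrM (gtr0_norm kappa_gt0) mulrAC ler_wpM2l // mulr_ge0 //.
  exact: ltW.
have m2 : `|(1 + kappa * bs.1.1.1) * d.1.1.2| <= `|1 + kappa * bs.1.1.1| * `|d|.
  by rewrite normrM ler_wpM2l.
have m3 : `|s * dslack X y bs d| <= K1 * `|d|.
  by rewrite normrM ger0_norm //; apply: le_trans H1; rewrite ler_piMl.
have m4 : `|e * d.1.1.1| <= `|d|.
  by rewrite normrM; apply: le_trans d1; rewrite ler_piMl.
have := ler_normD (kappa * d.1.1.1 * bs.1.1.2) ((1 + kappa * bs.1.1.1) * d.1.1.2).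
have := ler_normD (e * d.1.1.1) (s * dslack X y bs d).
have -> : K4 * `|d| = kappa * `|bs.1.1.2| * `|d| + `|1 + kappa * bs.1.1.1| * `|d| + `|d|.
  by rewrite /K4 !mulrDl mul1r.
lra.
Qed.

Lemma huber_partials_bounded (e t : R) : 0 < e ->
  0 <= huber_dt e t <= 1 /\ `|huber_de e t| <= 1.
Proof.
move=> e0; split; first exact: huber_dt_itv.
by have /andP[h1 h2] := huber_de_itv t e0; rewrite ler_norml h1 (le_trans h2).
Qed.

(** A perturbation argument: [dE b] is compared with the Jacobian at [bs] that carries the Huber
    partials of [b]. The radius makes [K1] times the difference at most [|d| / 2], which the
    left-hand side absorbs. *)
Lemma dE_map_uniformly_invertible (bs : point) :
  z_positive A X y bs -> 0 <= bs.1.1.1 ->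
  exists r K, [/\ 0 < r, 0 <= K & forall b d, `|b - bs| < r -> 0 < b.1.1.1 ->
    `|d| <= K * (`|d.1.1.1| + `|dE b d|) /\ `|dE b d| <= K * `|d|].
Proof.
move=> z0 es0.
have [K1 K10 H1] := jacobian_with_bounded_below z0 es0.
have [r [K2 [r0 K20 H2]]] := jacobian_with_lipschitz bs.
have [K3 K30 H3] := jacobian_with_bounded bs.
pose r' := Num.min r (2 * (K1 + 1) * (K2 + 1))^-1.
have q0 : 0 < 2 * (K1 + 1) * (K2 + 1) by rewrite !mulr_gt0 // ltr_wpDl.
exists r', (2 * K1 + (K3 + 1)); split.
- by rewrite lt_min r0 invr_gt0.
- by rewrite addr_ge0 ?mulr_ge0 // addr_ge0.
move=> b d; rewrite lt_min => /andP[br bq] e0.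
have [s01 e1] := huber_partials_bounded (slack X y b) e0.
rewrite /dE_map; move: (huber_dt _ _) (huber_de _ _) s01 e1 => s e s01 e1.
have {}H1 := H1 s e d s01 e1; have {}H3 := H3 s e d s01 e1.
have {}H2 := H2 s e b d s01 br.
have nd := normr_ge0 d.
have KK : 2 * (K1 + 1) * (K2 + 1) * `|b - bs| <= 1.
  by rewrite mulrC -ler_pdivlMr // div1r ltW.
have nb := normr_ge0 (b - bs).
have h1 : 2 * K1 * (K2 * `|b - bs|) <= 1.
  apply: le_trans KK; rewrite mulrA ler_wpM2r // -!mulrA ler_wpM2l //.
  by rewrite ler_pM ?lerDl.
have h2 : K2 * `|b - bs| <= 1.
  apply: le_trans KK; rewrite ler_wpM2r //.
  have : 0 <= K1 * K2 by rewrite mulr_ge0.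
  nra.
move: (J s e b d) (J s e bs d) H1 H2 H3 => Jb Js H1 H2 H3.
have t1 : `|Js| <= `|Jb| + K2 * `|b - bs| * `|d|.
  rewrite -[Js](subrK (Jb)) addrC.
  by apply: le_trans (ler_normD _ _) _; rewrite lerD2l distrC.
have t2 : `|Jb| <= `|Js| + K2 * `|b - bs| * `|d|.
  rewrite -[Jb](subrK (Js)) addrC.
  by apply: le_trans (ler_normD _ _) _; rewrite lerD2l.
have n1 := normr_ge0 (Jb); have n2 := normr_ge0 d.1.1.1.
split.
- have l1 : 2 * K1 * (K2 * `|b - bs|) * `|d| <= `|d| by rewrite ler_piMl.
  have l2 : K1 * `|Js| <= K1 * `|Jb| + K1 * (K2 * `|b - bs| * `|d|).
    by rewrite -mulrDr ler_wpM2l.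
  have l3 : 0 <= (K3 + 1) * (`|d.1.1.1| + `|Jb|).
    by apply: mulr_ge0; apply: addr_ge0.
  rewrite mulrDl; apply: ler_wpDr => //; rewrite mulrDr in H1 *; nra.
- have l1 : K2 * `|b - bs| * `|d| <= `|d| by rewrite ler_piMl.
  have l3 : 0 <= 2 * K1 * `|d| by rewrite !mulr_ge0.
  rewrite mulrDl mulrDl; lra.
Qed.

(** Linearizing at [b] and evaluating at [bs], as in semismooth Newton theory, calls for no
    derivative at [bs]. The Huber function itself leaves no error, by [huber_euler]. *)
Lemma E_map_semismooth (bs : point) : bs.1.1.1 = 0 ->
  exists r K, [/\ 0 < r, 0 <= K & forall b, `|b - bs| < r -> 0 < b.1.1.1 ->
    `|E b + dE b (bs - b) - E bs| <= K * `|b - bs| ^+ 2].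
Proof.
move=> es0.
have [ru ru0 Hu] := huber_euler (slack X y bs).
have [r1 [K1 [r10 _ K11 [H1 _ L1]]]] := c11_bounded (c11_slack X y bs).
have [r2 [K2 [r20 K20 H2]]] := c11_stationarity A X bs.
have [r3 [K3 [r30 K30 H3]]] := c11_lower_level X y bs.
have K10 : 0 < K1 by lra.
have bb r : 0 < r -> `|bs - bs| < r by rewrite subrr normr0.
(* [ru / K1] keeps the change of [slack] below [ru], and also [eps], because [K1 >= 1]. *)
exists (Num.min (Num.min r1 (ru / K1)) (Num.min r2 r3)), (kappa + K1 + K2 + K3); split.
- by rewrite !lt_min r10 r20 r30 divr_gt0.
- by rewrite !addr_ge0 // ltW.
move=> b; rewrite !lt_min => /andP[/andP[br1 bru] /andP[br2 br3]] e0.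
have [_ _ {}H1] := H1 b br1; have {}H1 := H1 bs (bb _ r10).
have [_ _ {}H2] := H2 b br2; have {}H2 := H2 bs (bb _ r20).
have [_ _ {}H3] := H3 b br3; have {}H3 := H3 bs (bb _ r30).
have {}L1 := L1 bs b (bb _ r10) br1.
rewrite (distrC bs b) in H1 H2 H3.
set t := `|b - bs| ^+ 2 in H1 H2 H3 *.
have t0 : 0 <= t by rewrite exprn_ge0.
have k1 : 0 <= K1 * t by rewrite mulr_ge0 // ltW.
have k2 : 0 <= K2 * t by rewrite mulr_ge0.
have k3 : 0 <= K3 * t by rewrite mulr_ge0.
have k4 : 0 <= kappa * t by rewrite mulr_ge0 // ltW.
have n2 (W : normedModType R) (p q v : W) : `|p + v - q| = `|q - p - v|.
  by rewrite -normrN !opprD opprK addrC addrA.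
rewrite !E_mapE ?es0 //; last exact: ltW.
have sumE : (kappa + K1 + K2 + K3) * t = kappa * t + K1 * t + K2 * t + K3 * t by ring.
rewrite norm_residual_le sumE; apply/and3P; split; first last.
- by rewrite -n2 in H3; apply: le_trans H3 _; lra.
- by rewrite -n2 in H2; apply: le_trans H2 _; lra.
have [/= b1 b2 _ _] := point_coord_le (b - bs).
rewrite es0 subr0 in b1.
have er : b.1.1.1 < ru.
  apply: le_lt_trans (ler_norm _) _; apply: le_lt_trans b1 _.
  by apply: lt_le_trans bru _; rewrite ler_pdivrMr // ler_peMr // ltW.
have tr : `|slack X y b - slack X y bs| < ru.
  by apply: le_lt_trans L1 _; rewrite mulrC -ltr_pdivlMr.
have [s01 _] := huber_partials_bounded (slack X y b) e0.
have := Hu _ _ e0 er tr.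
rewrite /dE_map /jacobian_with /= es0.
move: (huber_dt _ _) (huber_de _ _) s01 => s e /andP[s0 s1] HE.
(* Once [huber_euler] has replaced the Huber value at [bs], only the bilinear term in [eps] and [C]
   and the Taylor remainder of [slack] survive. *)
have alg (eb Cb Cs D h tb ts : R) :
    kappa * (eb * (Cs - Cb)) + s * (ts - tb - D) =
    (1 + kappa * eb) * Cb - h
    + (kappa * (0 - eb) * Cb + (1 + kappa * eb) * (Cs - Cb) - (e * (0 - eb) + s * D))
    - ((1 + kappa * 0) * Cs - (h - e * eb + s * (ts - tb))) by ring.
set D := dslack _ _ _ _ in H1 *.
suff : `|kappa * (b.1.1.1 * (bs.1.1.2 - b.1.1.2)) + s * (slack X y bs - slack X y b - D)|
    <= kappa * t + K1 * t + K2 * t + K3 * t.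
  by rewrite (alg _ _ _ _ (huber b.1.1.1 (slack X y b))) HE.
apply: le_trans (ler_normD _ _) _.
have m1 : `|kappa * (b.1.1.1 * (bs.1.1.2 - b.1.1.2))| <= kappa * t.
  rewrite normrM (gtr0_norm kappa_gt0) ler_wpM2l ?(ltW kappa_gt0) // normrM.
  by rewrite /t expr2 ler_pM // distrC.
have m2 : `|s * (slack X y bs - slack X y b - D)| <= K1 * t.
  by rewrite normrM ger0_norm //; apply: le_trans H1; rewrite ler_piMl.
by apply: le_trans (lerD m1 m2) _; rewrite -[leRHS]addrA lerDl addr_ge0.
Qed.

End LocalEstimates.

(** * Local analysis of the Newton step *)

Section EuclideanNorms.
Variables (R : realType) (N : nat).
Implicit Types (v : 'cV[R]_N) (p : SN_point R N) (e : SN_residual R N).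

Lemma sqnorm_ge0 v : 0 <= sqnorm v.
Proof. by apply: sumr_ge0 => i _; exact: sqr_ge0. Qed.

Lemma norm_sqr_le_sqnorm v : `|v| ^+ 2 <= sqnorm v.
Proof.
rewrite -[leRHS]sqr_sqrtr ?sqnorm_ge0 // lerXn2r ?nnegrE ?sqrtr_ge0 //.
apply: mx_norm_le => [|i j]; first exact: sqrtr_ge0.
rewrite -sqrtr_sqr ler_wsqrtr // (ord1 j) /sqnorm (bigD1 i) //= lerDl.
by apply: sumr_ge0 => k _; exact: sqr_ge0.
Qed.

Lemma sqnorm_le v : sqnorm v <= N%:R * `|v| ^+ 2.
Proof.
rewrite /sqnorm mulr_natl -[X in _ *+ X]card_ord -sumr_const.
apply: ler_sum => i _; rewrite -[leLHS]ger0_norm ?sqr_ge0 // normrX.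
by rewrite lerXn2r ?nnegrE // mx_coord_le.
Qed.

Lemma point_norm_sqr p :
  point_norm p ^+ 2 = p.1.1.1 ^+ 2 + p.1.1.2 ^+ 2 + sqnorm p.1.2 + sqnorm p.2.
Proof.
case: p => [[[a c] u] v] /=; rewrite sqr_sqrtr //.
by rewrite !addr_ge0 ?sqr_ge0 ?sqnorm_ge0.
Qed.

Lemma residual_norm_sqr e :
  residual_norm e ^+ 2 = e.1.1 ^+ 2 + sqnorm e.1.2 + sqnorm e.2.
Proof.
case: e => [[a u] v] /=; rewrite sqr_sqrtr //.
by rewrite !addr_ge0 ?sqr_ge0 ?sqnorm_ge0.
Qed.

Lemma point_norm_ge0 p : 0 <= point_norm p.
Proof. by case: p => [[[a c] u] v]; exact: sqrtr_ge0. Qed.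

Lemma residual_norm_ge0 e : 0 <= residual_norm e.
Proof. by case: e => [[a u] v]; exact: sqrtr_ge0. Qed.

Lemma norm_le_point_norm p : `|p| <= point_norm p.
Proof.
have S := point_norm_sqr p; have p0 := point_norm_ge0 p.
have q1 := sqr_ge0 p.1.1.1; have q2 := sqr_ge0 p.1.1.2.
have q3 := sqnorm_ge0 p.1.2; have q4 := sqnorm_ge0 p.2.
have h3 := norm_sqr_le_sqnorm p.1.2; have h4 := norm_sqr_le_sqnorm p.2.
rewrite norm_point_le; apply/and4P; split.
all: rewrite -(@ler_pXn2r _ 2) ?nnegrE // S -?normrX ?(ger0_norm q1) ?(ger0_norm q2).
- by rewrite -!addrA lerDl !addr_ge0.
- by rewrite -!addrA addrCA lerDl !addr_ge0.
- by apply: le_trans h3 _; rewrite [leRHS]addrAC lerDr !addr_ge0.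
- by apply: le_trans h4 _; rewrite lerDr !addr_ge0.
Qed.

Lemma norm_le_residual_norm e : `|e| <= residual_norm e.
Proof.
have S := residual_norm_sqr e; have p0 := residual_norm_ge0 e.
have q1 := sqr_ge0 e.1.1.
have q3 := sqnorm_ge0 e.1.2; have q4 := sqnorm_ge0 e.2.
have h3 := norm_sqr_le_sqnorm e.1.2; have h4 := norm_sqr_le_sqnorm e.2.
rewrite norm_residual_le; apply/and3P; split.
all: rewrite -(@ler_pXn2r _ 2) ?nnegrE // S -?normrX ?(ger0_norm q1).
- by rewrite -!addrA lerDl !addr_ge0.
- by apply: le_trans h3 _; rewrite [leRHS]addrAC lerDr !addr_ge0.
- by apply: le_trans h4 _; rewrite lerDr !addr_ge0.
Qed.

(** [2 + 2 N] bounds the ratio of the squared norms; being at least 1, it also bounds the ratio of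
    the norms, without a square root. *)
Definition norm_ratio : R := 2 + 2 * N%:R.

Lemma norm_ratio_ge1 : 1 <= norm_ratio.
Proof. by rewrite /norm_ratio; have := ler0n R N; lra. Qed.

Lemma point_norm_le p : point_norm p <= norm_ratio * `|p|.
Proof.
have c1 := norm_ratio_ge1.
rewrite -(@ler_pXn2r _ 2) ?nnegrE ?point_norm_ge0 ?mulr_ge0 //; last by lra.
rewrite point_norm_sqr exprMn.
have [h1 h2 h3 h4] := point_coord_le p.
have n0 := normr_ge0 p.
have sq (x : R) : 0 <= x -> x <= `|p| -> x ^+ 2 <= `|p| ^+ 2.
  by move=> x0 xp; rewrite lerXn2r ?nnegrE.
have := sq _ (normr_ge0 _) h1; rewrite -normrX ger0_norm ?sqr_ge0 // => {}h1.
have := sq _ (normr_ge0 _) h2; rewrite -normrX ger0_norm ?sqr_ge0 // => {}h2.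
have s3 := sqnorm_le p.1.2; have s4 := sqnorm_le p.2.
have {}h3 : N%:R * `|p.1.2| ^+ 2 <= N%:R * `|p| ^+ 2 by rewrite ler_wpM2l // sq.
have {}h4 : N%:R * `|p.2| ^+ 2 <= N%:R * `|p| ^+ 2 by rewrite ler_wpM2l // sq.
apply: (@le_trans _ _ (norm_ratio * `|p| ^+ 2)); last first.
  by rewrite ler_wpM2r ?exprn_ge0 // expr2 ler_peMl //; lra.
rewrite /norm_ratio mulrDl -mulrA; lra.
Qed.

Lemma residual_norm_le e : residual_norm e <= norm_ratio * `|e|.
Proof.
have : point_norm ((0, e.1.1, e.1.2, e.2) : SN_point R N) = residual_norm e.
  by case: e => [[a u] v] /=; rewrite expr0n add0r.
move=> <-; apply: le_trans (point_norm_le _) _.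
have c0 : 0 <= norm_ratio by have := norm_ratio_ge1; lra.
rewrite ler_wpM2l // norm_point_le normr0 normr_ge0 /=.
by have [-> -> ->] := residual_coord_le e.
Qed.

End EuclideanNorms.

Section Powers.
Variable R : realType.
Implicit Types x tau : R.

Lemma powR_small (M e tau : R) : 0 <= M -> 0 < e -> 0 < tau ->
  exists2 r : R, 0 < r & forall x, 0 <= x -> x < r -> M * x `^ tau <= e.
Proof.
move=> M0 e0 t0; have M1 : 0 < M + 1 by rewrite ltr_wpDl.
exists ((e / (M + 1)) `^ tau^-1) => [|x x0 xr].
  by rewrite powR_gt0 // divr_gt0.
have : x `^ tau <= e / (M + 1).
  rewrite -[leRHS](@powRr1 _ (e / (M + 1))) ?divr_ge0 ?(ltW e0) ?(ltW M1) //.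
  rewrite -[X in _ <= _ `^ X](@mulVf _ tau) ?gt_eqF // powRrM.
  by apply: ge0_ler_powR; rewrite ?nnegrE ?powR_ge0 ?(ltW t0) ?(ltW xr).
rewrite ler_pdivlMr // mulrC => h; apply: le_trans h.
by rewrite ler_wpM2r ?powR_ge0 // lerDl.
Qed.

Lemma powR1D x tau : 0 <= x -> 0 < tau -> x `^ (1 + tau) = x `^ tau * x.
Proof.
move=> x0 t0; rewrite powRD ?powRr1 ?[x * _]mulrC //.
by rewrite gt_eqF // addr_gt0.
Qed.

(** This is where [tau <= 1] enters: the quadratic remainder fits into the order [1 + tau]. *)
Lemma sqr_le_powR1D x tau : 0 <= x <= 1 -> 0 < tau <= 1 -> x ^+ 2 <= x `^ (1 + tau).
Proof.
move=> /andP[x0 x1] /andP[t0 t1]; rewrite powR1D // expr2 ler_wpM2r //.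
have [->|xn0] := eqVneq x 0; first exact: powR_ge0.
by rewrite ger1_powR // x1 lt_def xn0 x0.
Qed.

Lemma min1_powR_le x tau : 0 <= x -> 0 < tau -> Num.min 1 (x `^ (1 + tau)) <= x.
Proof.
move=> x0 t0; rewrite ge_min; have [//|/ltW x1 /=] := leP 1 x.
have [->|xn0] := eqVneq x 0.
  by rewrite powR0 ?lexx // gt_eqF // addr_gt0.
by rewrite ge1r_powR // ?lerDl ?(ltW t0) // x1 lt_def xn0 x0.
Qed.

End Powers.

Section NewtonStep.
Variables (R : realType) (M1 N M2 : nat) (A : 'M[R]_(M1, N)) (X : 'M[R]_(N, M2)).
Variables (y : 'cV[R]_M2) (kappa : R) (pr : SN_params R).
Hypotheses (kappa_gt0 : 0 < kappa) (pr_ok : SN_params_ok pr).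
Local Notation point := (SN_point R N).
Local Notation E := (E_map A X y kappa).
Local Notation Ehat := (E_hat A X y kappa).
Local Notation dE := (dE_map A X y kappa).
Local Notation nE b := (point_norm (E_hat A X y kappa b)).
Local Notation tau := (sn_tau pr).
Local Notation ratio := (norm_ratio R N).
Implicit Types b d : point.

Lemma E_hatE b : Ehat b = (b.1.1.1, (E b).1.1, (E b).1.2, (E b).2).
Proof. by case: b => [[[e C] mu] w]. Qed.

Lemma nE_ge b : `|b.1.1.1| <= nE b /\ `|E b| <= nE b.
Proof.
have [h1 h2 h3 h4] := point_coord_le (Ehat b).
have h := norm_le_point_norm (Ehat b).
rewrite {1}E_hatE /= in h1; rewrite {1}E_hatE /= in h2.
rewrite {1}E_hatE /= in h3; rewrite {1}E_hatE /= in h4.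
split; first exact: le_trans h.
by rewrite norm_residual_le (le_trans h2) // (le_trans h3) // (le_trans h4).
Qed.

Lemma nE_le b : nE b <= ratio * (`|b.1.1.1| + `|E b|).
Proof.
apply: le_trans (point_norm_le _) _.
rewrite ler_wpM2l ?(le_trans _ (norm_ratio_ge1 R N)) //.
have [h1 h2 h3] := residual_coord_le (E b).
rewrite E_hatE norm_point_le /= lerDl normr_ge0 /=.
by rewrite !ler_wpDl.
Qed.

Lemma nE_gt0 b : Ehat b <> 0 -> 0 < nE b.
Proof.
move=> /eqP h; apply: lt_le_trans (norm_le_point_norm _).
by rewrite normr_gt0.
Qed.

Lemma diff_E_map b d : 0 < b.1.1.1 -> 'd E b d = dE b d.
Proof.
move=> e0; have H := c11_is_diff (c11_E_map A X y kappa e0).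
by rewrite (diff_val (is_diff_def := H)).
Qed.

(** As the value of [dE] on a unit vector, the partial derivative inherits the uniform bound on the
    Jacobian. *)
Lemma nabla_eps_EE b : 0 < b.1.1.1 -> nabla_eps_E A X y kappa b = dE b (1, 0, 0, 0).
Proof.
case: b => [[[e C] mu] w] e0; rewrite /nabla_eps_E.
have H1 : c11 (fun s : R => s) (fun _ u => u) e.
  by apply: (@c11_linear _ _ _ _ 1) => // u; rewrite mul1r.
have H2 := c11_pair (c11_pair (c11_pair H1 (c11_cst C e)) (c11_cst mu e)) (c11_cst w e).
have H3 := c11_comp H2 (c11_E_map A X y kappa (b0 := (e, C, mu, w)) e0).
have H := c11_is_diff H3.
by rewrite derive1E deriveE ?(diff_val (is_diff_def := H)).
Qed.

(** The linear bound controls the size of the step and the constant [delta]; the bound of order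
    [1 + tau] gives the rate. *)
Lemma zeta_bounds (n : R) : 0 < n ->
  [/\ 0 < zeta_k pr n, zeta_k pr n <= sn_r pr * n &
      zeta_k pr n <= sn_r pr * n `^ (1 + tau)].
Proof.
move=> n0; have [[_ /andP[r0 _] _ _] [_ _ _ /andP[t0 _]]] := pr_ok.
rewrite /zeta_k; split.
- by rewrite mulr_gt0 // lt_min ltr01 powR_gt0.
- by rewrite ler_wpM2l ?(ltW r0) // min1_powR_le // ltW.
- by rewrite ler_wpM2l ?(ltW r0) // ge_min lexx orbT.
Qed.

(** [c11_E_map] does not reach [eps = 0]. Instead [E b - E bs] is the semismooth remainder minus
    [dE b (bs - b)], both at most linear in the distance. *)
Lemma E_map_lipschitz_at (bs : point) : z_positive A X y bs -> bs.1.1.1 = 0 ->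
  exists r L, [/\ 0 < r, 0 <= L & forall b, `|b - bs| < r -> 0 < b.1.1.1 ->
    `|E b - E bs| <= L * `|b - bs|].
Proof.
move=> z0 es0.
have es0' : 0 <= bs.1.1.1 by rewrite es0.
have [r1 [K1 [r10 K10 H1]]] := dE_map_uniformly_invertible kappa_gt0 z0 es0'.
have [r2 [K2 [r20 K20 H2]]] := E_map_semismooth A X y kappa_gt0 es0.
exists (Num.min 1 (Num.min r1 r2)), (K1 + K2); split.
- by rewrite !lt_min ltr01 r10 r20.
- by rewrite addr_ge0.
move=> b; rewrite !lt_min => /and3P[b1 br1 br2] e0.
have [_ {}H1] := H1 b (bs - b) br1 e0; have {}H2 := H2 b br2 e0.
rewrite distrC in H1; move: (dE b (bs - b)) H1 H2 => D H1 H2.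
have -> : E b - E bs = (E b + D - E bs) - D by rewrite [_ + D - _]addrAC addrK.
apply: le_trans (ler_normB _ _) _; rewrite mulrDl addrC; apply: lerD => //.
by apply: le_trans H2 _; rewrite expr2 ler_wpM2l // ler_piMl // ltW.
Qed.

(** At a zero of [E], [dE b (bs - b)] equals [- E b] up to a quadratic error; inverting [dE b]
    bounds the distance. *)
Lemma local_error_bound (bs : point) : z_positive A X y bs -> bs.1.1.1 = 0 ->
  E bs = 0 ->
  exists r L, [/\ 0 < r, 0 <= L & forall b, `|b - bs| < r -> 0 < b.1.1.1 ->
    `|b - bs| <= L * nE b].
Proof.
move=> z0 es0 Es0.
have es0' : 0 <= bs.1.1.1 by rewrite es0.
have [r1 [K1 [r10 K10 H1]]] := dE_map_uniformly_invertible kappa_gt0 z0 es0'.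
have [r2 [K2 [r20 K20 H2]]] := E_map_semismooth A X y kappa_gt0 es0.
pose q := 2 * (K1 + 1) * (K2 + 1).
have q0 : 0 < q by rewrite !mulr_gt0 // ltr_wpDl.
(* With [x = |b - bs|], inversion gives [x <= K1 (2 nE + K2 x^2)]; the radius makes
   [K1 K2 x <= 1/2], whence [x <= 4 K1 nE]. *)
exists (Num.min q^-1 (Num.min r1 r2)), (4 * K1); split.
- by rewrite !lt_min invr_gt0 q0 r10 r20.
- by rewrite mulr_ge0.
move=> b; rewrite !lt_min => /and3P[bq br1 br2] e0.
have [{}H1 _] := H1 b (bs - b) br1 e0; have {}H2 := H2 b br2 e0.
have [n1 n2] := nE_ge b.
rewrite Es0 subr0 in H2.
rewrite distrC in H1; move: (dE b (bs - b)) (E b) H1 H2 n2 => D Eb H1 H2 n2.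
have D1 : `|D| <= `|Eb| + K2 * `|b - bs| ^+ 2.
  rewrite -[D](addKr Eb) [`|_ + _|](_ : _ = `|(Eb + D) - Eb|); last first.
    by rewrite addrC.
  by apply: le_trans (ler_normB _ _) _; rewrite addrC lerD2l.
have de : `|(bs - b).1.1.1| <= nE b.
  by rewrite [_.1.1.1](_ : _ = bs.1.1.1 - b.1.1.1) // es0 sub0r normrN.
have nb := normr_ge0 (b - bs).
have qb : q * `|b - bs| <= 1 by rewrite mulrC -ler_pdivlMr // div1r ltW.
have h1 : 2 * K1 * (K2 * `|b - bs|) <= 1.
  apply: le_trans qb; rewrite mulrA ler_wpM2r // /q -!mulrA ler_wpM2l //.
  by rewrite ler_pM ?lerDl.
have h2 : 2 * K1 * (K2 * `|b - bs|) * `|b - bs| <= `|b - bs| by rewrite ler_piMl.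
have h3 : `|b - bs| <= K1 * (2 * nE b + K2 * `|b - bs| ^+ 2).
  apply: le_trans H1 _; rewrite ler_wpM2l //; lra.
rewrite mulrDr in h3.
have h4 : K1 * (K2 * `|b - bs| ^+ 2) = K1 * (K2 * `|b - bs|) * `|b - bs|.
  by rewrite expr2 !mulrA.
rewrite h4 in h3; lra.
Qed.

End NewtonStep.

Section LocalConvergence.
Variables (R : realType) (M1 N M2 : nat) (A : 'M[R]_(M1, N)) (X : 'M[R]_(N, M2)).
Variables (y : 'cV[R]_M2) (kappa : R) (pr : SN_params R).
Hypotheses (kappa_gt0 : 0 < kappa) (pr_ok : SN_params_ok pr).
Local Notation point := (SN_point R N).
Local Notation E := (E_map A X y kappa).
Local Notation Ehat := (E_hat A X y kappa).
Local Notation dE := (dE_map A X y kappa).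
Local Notation nE b := (point_norm (E_hat A X y kappa b)).
Local Notation tau := (sn_tau pr).
Local Notation ratio := (norm_ratio R N).
Implicit Types b d : point.

Lemma dE_map_linear b : 0 < b.1.1.1 -> linear_map (dE b).
Proof.
move=> /(c11_E_map A X y kappa)[r [K [r0 _ H]]].
by have [] := H b; rewrite ?subrr ?normr0.
Qed.

(** Uniform invertibility is applied to [b + d - bs], whose [eps] entry and image under [dE b] are
    both small. Positivity of the new [eps] is recorded because the Lipschitz estimate will be used
    at [b + d]. *)
Lemma direction_error (bs : point) : z_positive A X y bs -> bs.1.1.1 = 0 ->
  E bs = 0 ->
  exists r c, [/\ 0 < r, 0 <= c & forall b d, `|b - bs| < r -> 0 < b.1.1.1 ->
    Ehat b <> 0 -> SN_direction A X y kappa pr b d ->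
    `|b + d - bs| <= c * `|b - bs| `^ (1 + tau) /\ 0 < (b + d).1.1.1].
Proof.
move=> z0 es0 Es0.
have [[eh0 /andP[r0 _] _ _] [rh0 _ _ /andP[t0 t1]]] := pr_ok.
have es0' : 0 <= bs.1.1.1 by rewrite es0.
have [r1 [K1 [r10 K10 H1]]] := dE_map_uniformly_invertible kappa_gt0 z0 es0'.
have [r2 [K2 [r20 K20 H2]]] := E_map_semismooth A X y kappa_gt0 es0.
have [r3 [L [r30 L0 H3]]] := E_map_lipschitz_at kappa_gt0 z0 es0.
have c1 : 1 <= ratio := norm_ratio_ge1 R N.
have c0 : 0 <= ratio by lra.
(* With [x = |b - bs|]: [nE b <= Ln x], the new [eps] is at most [Ke x^(1 + tau)],
   [|d eps| <= K4 x], and the Newton residual is at most [K5 x^(1 + tau)]. *)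
pose Ln := ratio * (1 + L).
have Ln0 : 0 <= Ln by rewrite mulr_ge0 // addr_ge0.
pose Ke := sn_r pr * Ln `^ (1 + tau) * sn_eps_hat pr.
have Ke0 : 0 <= Ke by rewrite !mulr_ge0 ?powR_ge0 // ltW.
pose K4 := 1 + sn_r pr * Ln * sn_eps_hat pr.
have K40 : 0 <= K4.
  by rewrite addr_ge0 // mulr_ge0 ?(ltW eh0) // mulr_ge0 // ltW.
pose K5 := sn_r_hat pr * Ln `^ tau * (ratio * (L + K4 * K1)).
have K50 : 0 <= K5.
  apply: mulr_ge0; first by rewrite mulr_ge0 ?powR_ge0 // ltW.
  by rewrite mulr_ge0 // addr_ge0 // mulr_ge0.
exists (Num.min 1 (Num.min r1 (Num.min r2 r3))), (K1 * (Ke + (K5 + K2))); split.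
- by rewrite !lt_min ltr01 r10 r20 r30.
- by rewrite mulr_ge0 // addr_ge0 // addr_ge0.
move=> b d; rewrite !lt_min => /and4P[b1 br1 br2 br3] e0 Eb0 [deq Hres _].
have n0 := nE_gt0 Eb0.
have [zeta0 zeta1 zeta2] := zeta_bounds pr_ok n0.
set n := nE b in n0 zeta0 zeta1 zeta2 deq Hres.
set x := `|b - bs| in b1 br1 br2 br3 *.
have x0 : 0 <= x := normr_ge0 _.
have ex : `|b.1.1.1| <= x.
  have [/= h _ _ _] := point_coord_le (b - bs).
  by rewrite es0 subr0 in h.
have Ex : `|E b| <= L * x by have := H3 b br3 e0; rewrite Es0 subr0.
have nx : n <= Ln * x.
  apply: le_trans (nE_le _ _ _ _ _) _; rewrite /Ln -[leRHS]mulrA ler_wpM2l //.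
  by rewrite mulrDl mul1r lerD.
have epsE : (b + d).1.1.1 = zeta_k pr n * sn_eps_hat pr.
  by rewrite [LHS]/= deq addrA subrr add0r.
split; last by rewrite epsE mulr_gt0.
have zeh : 0 <= zeta_k pr n * sn_eps_hat pr := mulr_ge0 (ltW zeta0) (ltW eh0).
have zx : `|zeta_k pr n * sn_eps_hat pr| <= Ke * x `^ (1 + tau).
  rewrite ger0_norm // /Ke [leRHS]mulrAC ler_wpM2r ?(ltW eh0) //.
  apply: le_trans zeta2 _; rewrite -mulrA ler_wpM2l ?(ltW r0) // -powRM //.
  by apply: ge0_ler_powR; rewrite ?nnegrE ?mulr_ge0 ?(ltW n0) ?addr_ge0 ?(ltW t0).
rewrite diff_E_map // in Hres; set Res := E b + dE b d in Hres.
have Rx : `|Res| <= K5 * x `^ (1 + tau).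
  apply: le_trans (norm_le_residual_norm _) _; apply: le_trans Hres _.
  have -> : K5 * x `^ (1 + tau) = (sn_r_hat pr * (Ln `^ tau * x `^ tau)) *
      (ratio * ((L + K4 * K1) * x)) by rewrite powR1D // /K5; ring.
  apply: ler_pM; rewrite ?residual_norm_ge0 //.
  - by rewrite /eta_k le_min ler01 mulr_ge0 ?powR_ge0 // ltW.
  - rewrite /eta_k ge_min; apply/orP; right; rewrite ler_wpM2l ?(ltW rh0) //.
    rewrite -powRM //.
    by apply: ge0_ler_powR; rewrite ?nnegrE ?mulr_ge0 ?(ltW n0) ?addr_ge0 ?(ltW t0).
  apply: le_trans (residual_norm_le _) _; rewrite ler_wpM2l //.
  apply: le_trans (ler_normD _ _) _; rewrite mulrDl lerD // normrZ.
  rewrite nabla_eps_EE // [leRHS]mulrAC; apply: ler_pM => //.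
    rewrite deq; apply: le_trans (ler_normD _ _) _; rewrite normrN.
    rewrite (ger0_norm zeh) /K4 mulrDl mul1r lerD // [leRHS]mulrAC ler_wpM2r ?(ltW eh0) //.
    by apply: le_trans zeta1 _; rewrite -mulrA ler_wpM2l ?(ltW r0).
  have [_ h] := H1 b ((1, 0, 0, 0) : point) br1 e0.
  apply: le_trans h _; rewrite ler_piMr //.
  by rewrite norm_point_le /= !normr0 normr1 !ler01 lexx.
have linb := dE_map_linear e0.
(* The image is the Newton residual minus the semismooth remainder. *)
have uE : dE b (b + d - bs) = Res - (E b + dE b (bs - b)).
  have -> : b + d - bs = d - (bs - b) by rewrite opprB addrCA addrA.
  by rewrite (linear_mapB linb) opprD addrACA subrr add0r.
have [h _] := H1 b (b + d - bs) br1 e0.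
apply: le_trans h _; rewrite -mulrA ler_wpM2l // mulrDl.
have ue : (b + d - bs).1.1.1 = zeta_k pr n * sn_eps_hat pr.
  rewrite -epsE [LHS](_ : _ = (b + d).1.1.1 - bs.1.1.1) //.
  by rewrite es0 subr0.
rewrite ue lerD // uE; apply: le_trans (ler_normB _ _) _.
rewrite mulrDl lerD //.
have := H2 b br2 e0; rewrite Es0 subr0 => h2; apply: le_trans h2 _.
by rewrite ler_wpM2l // sqr_le_powR1D ?t0 ?t1 // x0 ltW.
Qed.

(** Lipschitz bound at [b + d], rate of the direction and error bound at [b] chain into
    [nE (b + d) <= M x^tau nE b] with [x = |b - bs|] and [M] constant; shrinking [x] makes the
    factor as small as needed. *)
Lemma newton_step_accepted (bs : point) : z_positive A X y bs -> bs.1.1.1 = 0 ->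
  E bs = 0 ->
  exists r c, [/\ 0 < r, 0 <= c & forall b d, `|b - bs| < r -> 0 < b.1.1.1 ->
    Ehat b <> 0 -> SN_direction A X y kappa pr b d ->
    [/\ `|b + d - bs| <= c * `|b - bs| `^ (1 + tau),
        `|b + d - bs| <= 2^-1 * `|b - bs| &
        SN_armijo A X y kappa pr b d 0]].
Proof.
move=> z0 es0 Es0.
have [[_ _ _ d1] [_ _ /andP[s0 s1] /andP[t0 t1]]] := pr_ok.
have [r1 [c [r10 c0 H1]]] := direction_error z0 es0 Es0.
have [r2 [L [r20 L0 H2]]] := E_map_lipschitz_at kappa_gt0 z0 es0.
have [r3 [K [r30 K0 H3]]] := local_error_bound kappa_gt0 z0 es0 Es0.
have ratio0 : 0 <= ratio by apply: le_trans (norm_ratio_ge1 R N).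
have d0 : 0 <= SN_delta pr.
  have [[_ _ eta0 _] _] := pr_ok.
  by rewrite mulr_ge0 ?sqrtr_ge0 // le_max (ltW eta0) orbT.
(* [q] is the factor of the line search at step 1. The merit function is a square and [q^2 <= q], so
   shrinking [nE] by [q] is enough. *)
pose q := 1 - 2 * sn_sigma pr * (1 - SN_delta pr).
have q0 : 0 < q by rewrite /q; nra.
have q1 : q <= 1 by rewrite /q; nra.
have Mc0 : 0 <= ratio * (1 + L) * c * K by rewrite !mulr_ge0 // addr_ge0.
have [r4 r40 H4] := powR_small Mc0 q0 t0.
have half0 : 0 < 2^-1 :> R by rewrite invr_gt0.
have [r5 r50 H5] := powR_small c0 half0 t0.
exists (Num.min r1 (Num.min r2 (Num.min r3 (Num.min r4 r5)))), c; split => //.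
  by rewrite !lt_min r10 r20 r30 r40.
move=> b d; rewrite !lt_min => /and5P[br1 br2 br3 br4 br5] e0 Eb0 dir.
have [h1 e1] := H1 b d br1 e0 Eb0 dir.
set x := `|b - bs| in h1 br1 br2 br3 br4 br5 *.
have x0 : 0 <= x := normr_ge0 _.
have h5 := H5 x x0 br5; have h4 := H4 x x0 br4.
have half : `|b + d - bs| <= 2^-1 * x.
  by apply: le_trans h1 _; rewrite powR1D // mulrA ler_wpM2r.
split => //.
have n0 := nE_gt0 Eb0.
have bd2 : `|b + d - bs| < r2 by apply: le_lt_trans half _; lra.
have ne : nE (b + d) <= q * nE b.
  have xb := H3 b br3 e0; rewrite -/x in xb.
  have Lb := H2 (b + d) bd2 e1; rewrite Es0 subr0 in Lb.
  have eb : `|(b + d).1.1.1| <= `|b + d - bs|.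
    have [h _ _ _] := point_coord_le (b + d - bs).
    rewrite [_.1.1.1](_ : _ = (b + d).1.1.1 - bs.1.1.1) // in h.
    by rewrite es0 subr0 in h.
  apply: (@le_trans _ _ (ratio * ((1 + L) * `|b + d - bs|))).
    apply: le_trans (nE_le _ _ _ _ _) _; rewrite ler_wpM2l //.
    by rewrite mulrDl mul1r lerD.
  apply: (@le_trans _ _ (ratio * ((1 + L) * (c * (x `^ tau * (K * nE b)))))).
    rewrite ler_wpM2l // ler_wpM2l ?addr_ge0 //; apply: le_trans h1 _.
    by rewrite powR1D // ler_wpM2l // ler_wpM2l ?powR_ge0.
  have -> : ratio * ((1 + L) * (c * (x `^ tau * (K * nE b)))) =
    ratio * (1 + L) * c * K * x `^ tau * nE b by ring.
  by rewrite ler_wpM2r ?(ltW n0).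
rewrite /SN_armijo expr0 scale1r mulr1 -/q /psi.
apply: (@le_trans _ _ ((q * nE b) ^+ 2)).
  by rewrite lerXn2r ?nnegrE ?point_norm_ge0 // mulr_ge0 ?(ltW q0) ?(ltW n0).
by rewrite exprMn ler_wpM2r ?exprn_ge0 ?point_norm_ge0 // expr2 ler_piMl // ltW.
Qed.

End LocalConvergence.

(** * Global convergence of the line search *)

Section QuadraticEstimates.
Variables (R : realType) (N : nat).
Implicit Types p q : SN_point R N.

Lemma sqnorm_comb_le (n : nat) (l m a c : R) (u v : 'cV[R]_n) :
  (forall x z : R, (l * x + m * z) ^+ 2 <= a * x ^+ 2 + c * z ^+ 2) ->
  sqnorm (l *: u + m *: v) <= a * sqnorm u + c * sqnorm v.
Proof.
move=> H; rewrite /sqnorm !mulr_sumr -big_split /=.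
by apply: ler_sum => i _; rewrite !mxE.
Qed.

Lemma point_norm_comb_le (l m a c : R) p q :
  (forall x z : R, (l * x + m * z) ^+ 2 <= a * x ^+ 2 + c * z ^+ 2) ->
  point_norm (l *: p + m *: q) ^+ 2 <= a * point_norm p ^+ 2 + c * point_norm q ^+ 2.
Proof.
move=> H; rewrite !point_norm_sqr.
case: p => [[[p1 p2] p3] p4]; case: q => [[[q1 q2] q3] q4] /=.
have := H p1 q1; have := H p2 q2.
have := sqnorm_comb_le p3 q3 H; have := sqnorm_comb_le p4 q4 H.
move: (sqnorm (_ + _)) (sqnorm (_ + _)) => s3 s4.
move: (sqnorm _) (sqnorm _) (sqnorm _) (sqnorm _) => *.
rewrite -![_ *: _]/(_ * _); lra.
Qed.

Lemma point_norm_convex (t : R) p q : 0 <= t <= 1 ->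
  point_norm ((1 - t) *: p + t *: q) ^+ 2 <=
    (1 - t) * point_norm p ^+ 2 + t * point_norm q ^+ 2.
Proof.
move=> /andP[t0 t1]; apply: point_norm_comb_le => x z.
have h : 0 <= (1 - t) * t * (x - z) ^+ 2.
  by apply: mulr_ge0; [apply: mulr_ge0; lra|exact: sqr_ge0].
rewrite -subr_ge0; apply: le_trans h _.
by rewrite le_eqVlt; apply/orP; left; apply/eqP; ring.
Qed.

(** Young's inequality: the gap in each coordinate is [s^-1 (s x - z)^2]. The weight [s] will be
    proportional to the step length. *)
Lemma point_normD_sqr (s : R) p q : 0 < s ->
  point_norm (p + q) ^+ 2 <=
    (1 + s) * point_norm p ^+ 2 + (1 + s^-1) * point_norm q ^+ 2.
Proof.
move=> s0; rewrite -[p in leLHS]scale1r -[q in leLHS]scale1r.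
apply: point_norm_comb_le => x z.
have h : 0 <= s^-1 * (s * x - z) ^+ 2 by rewrite mulr_ge0 ?sqr_ge0 // invr_ge0 ltW.
rewrite -subr_ge0; apply: le_trans h _.
by rewrite le_eqVlt; apply/orP; left; apply/eqP; field; rewrite gt_eqF.
Qed.

Lemma residual_comb_point (t a c : R) (e f g : SN_residual R N) :
  ((1 - t) * a + t * c, ((1 - t) *: e + t *: f + g).1.1,
     ((1 - t) *: e + t *: f + g).1.2, ((1 - t) *: e + t *: f + g).2) =
  (1 - t) *: ((a, e.1.1, e.1.2, e.2) : SN_point R N)
  + t *: ((c, f.1.1, f.1.2, f.2) : SN_point R N) + (0, g.1.1, g.1.2, g.2).
Proof.
move: e f g => [[? ?] ?] [[? ?] ?] [[? ?] ?] /=.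
by rewrite -[in LHS](addr0 (_ + t * c)).
Qed.

(** [n] and [P] are the residual norms before and after the step, [V] that of the Newton target, [S]
    that of the convex combination, [W] that of the Taylor error. Convexity gives the factor
    [1 - t (1 - del^2)], which beats the required one by at least [t gam]; the Young weight spends
    half of this margin, the Taylor error the other half. *)
Lemma sufficient_decrease (del sig Q m n t P W V S : R) :
  let gam := (1 - del) * (1 - 2 * sig) in
  0 <= del -> del < 1 -> 0 < sig -> sig < 2^-1 -> 0 <= Q ->
  0 < m <= n -> 0 < t <= 1 ->
  (Q * (1 + 2 / gam) + 1) * t <= gam / 2 * m ^+ 2 ->
  S ^+ 2 <= (1 - t) * n ^+ 2 + t * V ^+ 2 -> V ^+ 2 <= del ^+ 2 * n ^+ 2 ->
  W ^+ 2 <= Q * t ^+ 4 ->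
  P ^+ 2 <= (1 + t * gam / 2) * S ^+ 2 + (1 + (t * gam / 2)^-1) * W ^+ 2 ->
  P ^+ 2 <= (1 - 2 * sig * (1 - del) * t) * n ^+ 2.
Proof.
move=> gam d0 d1 s0 s1 Q0 /andP[m0 mn'] /andP[t0 tle1] h cvx target wn add.
have n0 : 0 < n by exact: lt_le_trans mn'.
have gam0 : 0 < gam by rewrite mulr_gt0 //; lra.
have sg0 : 0 < t * gam / 2 by rewrite divr_gt0 // mulr_gt0.
set B := Q * (1 + 2 / gam) + 1 in h.
have n20 : 0 < n ^+ 2 by rewrite exprn_gt0.
have mn : m ^+ 2 <= n ^+ 2 by rewrite lerXn2r ?nnegrE ?(ltW m0) ?(ltW n0).
have f1 : S ^+ 2 <= (1 - t * (1 - del ^+ 2)) * n ^+ 2.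
  apply: le_trans cvx _.
  have : t * V ^+ 2 <= t * (del ^+ 2 * n ^+ 2) by rewrite ler_wpM2l ?(ltW t0).
  lra.
have dd : 0 <= 1 - del ^+ 2 by rewrite subr_ge0 expr_le1 // ltW.
have f2 : (1 + t * gam / 2) * S ^+ 2 <=
    (1 - t * (1 - del ^+ 2) + t * gam / 2) * n ^+ 2.
  apply: (@le_trans _ _ ((1 + t * gam / 2) * ((1 - t * (1 - del ^+ 2)) * n ^+ 2))).
    by rewrite ler_wpM2l // addr_ge0 // ltW.
  rewrite mulrA ler_wpM2r ?(ltW n20) //.
  have : 0 <= t * gam / 2 * (t * (1 - del ^+ 2)).
    by rewrite mulr_ge0 ?(ltW sg0) // mulr_ge0 // ltW.
  lra.
have f3 : (1 + (t * gam / 2)^-1) * W ^+ 2 <= t * gam / 2 * n ^+ 2.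
  apply: (@le_trans _ _ ((1 + (t * gam / 2)^-1) * (Q * t ^+ 4))).
    by rewrite ler_wpM2l // addr_ge0 // invr_ge0 ltW.
  have -> : (1 + (t * gam / 2)^-1) * (Q * t ^+ 4) = Q * (t + 2 / gam) * t ^+ 3.
    by field; rewrite !gt_eqF.
  apply: (@le_trans _ _ (B * t * t)).
    have t3 : t ^+ 3 <= t * t.
      by rewrite 2!exprS expr1 ler_wpM2l ?(ltW t0) // ler_piMr ?(ltW t0).
    have h1 : Q * (t + 2 / gam) <= B.
      rewrite /B; apply: ler_wpDr => //; rewrite ler_wpM2l //; lra.
    have h2 : 0 <= Q * (t + 2 / gam).
      by rewrite mulr_ge0 // addr_ge0 ?(ltW t0) // divr_ge0 // ltW.
    by rewrite -[leRHS]mulrA ler_pM // exprn_ge0 // ltW.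
  have h' : gam / 2 * m ^+ 2 <= gam / 2 * n ^+ 2.
    by rewrite ler_wpM2l // divr_ge0 // ltW.
  have := ler_wpM2r (ltW t0) (le_trans h h'); lra.
have g1 : gam <= 1 - del ^+ 2 - 2 * sig * (1 - del).
  have : 0 <= (1 - del) * del by rewrite mulr_ge0 //; lra.
  by rewrite /gam expr2; lra.
have g2 := ler_wpM2l (ltW t0) g1.
have g3 := ler_wpM2r (ltW n20) g2.
apply: le_trans add _; apply: le_trans (lerD f2 f3) _.
move: g3; move: (n ^+ 2) (del ^+ 2) => nn dd' g3; lra.
Qed.

End QuadraticEstimates.

Section GlobalConvergence.
Variables (R : realType) (M1 N M2 : nat) (A : 'M[R]_(M1, N)) (X : 'M[R]_(N, M2)).
Variables (y : 'cV[R]_M2) (kappa : R) (pr : SN_params R).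
Hypotheses (kappa_gt0 : 0 < kappa) (pr_ok : SN_params_ok pr).
Local Notation point := (SN_point R N).
Local Notation E := (E_map A X y kappa).
Local Notation Ehat := (E_hat A X y kappa).
Local Notation dE := (dE_map A X y kappa).
Local Notation nE b := (point_norm (E_hat A X y kappa b)).
Local Notation tau := (sn_tau pr).
Local Notation delta := (SN_delta pr).
Local Notation sigma := (sn_sigma pr).
Local Notation rho := (sn_rho pr).
Local Notation ratio := (norm_ratio R N).
Implicit Types d : point.

Lemma delta_ge0 : 0 <= delta.
Proof.
have [[_ _ eta0 _] _] := pr_ok.
by rewrite mulr_ge0 ?sqrtr_ge0 // le_max (ltW eta0) orbT.
Qed.

(** Origin of the square root of 2 in [SN_delta]: the new [eps] and the Newton residual are each at
    most the maximum in [SN_delta] times [nE], and their squares add. *)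
Lemma direction_target_le (b : point) d Res : 0 < b.1.1.1 -> Ehat b <> 0 ->
  SN_direction A X y kappa pr b d ->
  Res = E b + dE b d ->
  point_norm ((zeta_k pr (nE b) * sn_eps_hat pr, Res.1.1, Res.1.2, Res.2) : point) ^+ 2
    <= delta ^+ 2 * nE b ^+ 2.
Proof.
move=> e0 Eb0 [_ _]; rewrite diff_E_map // => Hres ResE; rewrite -ResE in Hres.
have [[eh0 /andP[r0 _] et0 _] _] := pr_ok.
have n0 := nE_gt0 Eb0; have [z0 z1 _] := zeta_bounds pr_ok n0.
rewrite point_norm_sqr /= -!addrA (addrA (Res.1.1 ^+ 2)) -residual_norm_sqr.
rewrite /SN_delta [(Num.sqrt 2 * _) ^+ 2]exprMn sqr_sqrtr //; set M := Num.max _ _.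
have rM : sn_r pr * sn_eps_hat pr <= M by rewrite le_max lexx.
have eM : sn_eta_hat pr <= M by rewrite le_max lexx orbT.
have M0 : 0 <= M by rewrite le_max (ltW et0) orbT.
set n := nE b in n0 z0 z1 Hres *.
have a1 : (zeta_k pr n * sn_eps_hat pr) ^+ 2 <= (M * n) ^+ 2.
  rewrite lerXn2r ?nnegrE ?(mulr_ge0 (ltW z0) (ltW eh0)) ?(mulr_ge0 M0 (ltW n0)) //.
  apply: le_trans (ler_wpM2r (ltW eh0) z1) _.
  by rewrite mulrAC ler_wpM2r ?(ltW n0).
have a2 : residual_norm Res ^+ 2 <= (M * n) ^+ 2.
  rewrite lerXn2r ?nnegrE ?residual_norm_ge0 ?(mulr_ge0 M0 (ltW n0)) //.
  by apply: le_trans Hres _; rewrite ler_wpM2r ?(ltW n0).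
have -> : 2 * M ^+ 2 * n ^+ 2 = 2 * (M * n) ^+ 2 by ring.
lra.
Qed.

(** Up to a Taylor error of order [t^2], [Ehat] at [b + t d] is the convex combination of [Ehat b]
    and the Newton target. Bounds on [nE] bound [d], hence the error, uniformly. *)
Lemma armijo_uniform (bs : point) (m1 m2 : R) :
  z_positive A X y bs -> 0 < bs.1.1.1 -> 0 < m1 ->
  exists r t0, [/\ 0 < r, 0 < t0 <= 1 & forall b d t, `|b - bs| < r ->
    0 < b.1.1.1 -> Ehat b <> 0 -> m1 <= nE b <= m2 ->
    SN_direction A X y kappa pr b d -> 0 < t <= t0 ->
    psi A X y kappa (b + t *: d) <=
      (1 - 2 * sigma * (1 - delta) * t) * psi A X y kappa b].
Proof.
move=> z0 es0 m10.
have [[eh0 /andP[r0 _] et0 d1] [_ _ /andP[s0 s1] _]] := pr_ok.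
have d0 := delta_ge0.
have [r1 [K1 [r10 K10 H1]]] := c11_E_map A X y kappa es0.
have [r2 [K2 [r20 K20 H2]]] := dE_map_uniformly_invertible kappa_gt0 z0 (ltW es0).
have re0 : 0 < sn_r pr * sn_eps_hat pr by rewrite mulr_gt0.
(* The [eps] entry of [d] is at most [(1 + r eps_hat) nE], and [dE b d], the Newton residual minus
   [E b], at most [(1 + eta_hat) nE]. *)
pose D := K2 * (2 + sn_r pr * sn_eps_hat pr + sn_eta_hat pr) * `|m2| + 1.
have D0 : 0 < D.
  by rewrite ltr_wpDl // !mulr_ge0 //; lra.
pose Q := (ratio * (K1 * D ^+ 2)) ^+ 2.
have Q0 : 0 <= Q by exact: sqr_ge0.
pose gam := (1 - delta) * (1 - 2 * sigma).
have gam0 : 0 < gam by rewrite mulr_gt0 //; lra.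
pose B := Q * (1 + 2 / gam) + 1.
have QB0 : 0 <= Q * (1 + 2 / gam) by rewrite mulr_ge0 // addr_ge0 // divr_ge0 // ltW.
have B0 : 0 < B by rewrite ltr_wpDl.
(* [tA] fits the Taylor error into the margin of [sufficient_decrease]; [tB / 2] keeps [t d] within
   [r1 / 4], so the trial point stays in the ball of the Taylor estimate. *)
pose tA := gam / 2 * m1 ^+ 2 / B.
have tA0 : 0 < tA by rewrite !divr_gt0 // mulr_gt0 ?exprn_gt0 // divr_gt0.
pose tB := r1 / 2 / D.
have tB0 : 0 < tB by rewrite !divr_gt0.
exists (Num.min (r1 / 2) r2), (Num.min (2^-1) (Num.min tA (tB / 2))); split.
- by rewrite lt_min divr_gt0.
- by rewrite !lt_min tA0 invr_gt0 ltr0n divr_gt0 //= ge_min; apply/orP; left; lra.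
move=> b d t; rewrite lt_min => /andP[br1 br2] e0 Eb0 /andP[n1 n2] dir.
move=> /andP[t0]; rewrite !le_min => /and3P[th ta tb].
have tle1 : t <= 1 by lra.
have n0 := nE_gt0 Eb0.
have target := direction_target_le e0 Eb0 dir erefl.
have [zeta0 zeta1 _] := zeta_bounds pr_ok n0.
have [ne1 ne2] := nE_ge A X y kappa b.
have linb := dE_map_linear A X y kappa e0.
have [{}H2 _] := H2 b d br2 e0.
case: dir => deq _; rewrite diff_E_map // => Hres.
move: Hres target.
set Res := E b + dE b d; set n := nE b in n0 n1 n2 zeta0 zeta1 deq ne1 ne2 *.
move=> Hres target.
have dD : `|d| <= D.
  apply: le_trans H2 _.
  have h1 : `|d.1.1.1| <= (1 + sn_r pr * sn_eps_hat pr) * n.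
    rewrite deq; apply: le_trans (ler_normD _ _) _; rewrite normrN mulrDl mul1r.
    apply: lerD => //; rewrite ger0_norm; last exact: mulr_ge0 (ltW zeta0) (ltW eh0).
    by apply: le_trans (ler_wpM2r (ltW eh0) zeta1) _; rewrite mulrAC.
  have h2 : `|dE b d| <= (1 + sn_eta_hat pr) * n.
    have -> : dE b d = Res - E b by rewrite /Res addrC addKr.
    apply: le_trans (ler_normB _ _) _; rewrite addrC mulrDl mul1r lerD //.
    by apply: le_trans (norm_le_residual_norm _) Hres.
  have h3 : n <= `|m2| by apply: le_trans n2 (ler_norm _).
  apply: (@le_trans _ _ (K2 * ((2 + sn_r pr * sn_eps_hat pr + sn_eta_hat pr) * n))).
    by rewrite ler_wpM2l //; move: h1 h2; rewrite !mulrDl !mul1r; lra.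
  rewrite /D mulrA; apply: ler_wpDr => //; rewrite ler_wpM2l // mulr_ge0 //; lra.
have btr : `|b + t *: d - bs| < r1.
  rewrite addrAC; apply: le_lt_trans (ler_normD _ _) _.
  have : `|t *: d| <= r1 / 2 / 2.
    rewrite normrZ gtr0_norm //.
    apply: (@le_trans _ _ (tB / 2 * D)); first exact: ler_pM (ltW t0) _ tb dD.
    by rewrite /tB mulrAC mulfVK // gt_eqF.
  lra.
have br1' : `|b - bs| < r1 by lra.
have [_ _ /(_ _ btr)] := H1 b br1'.
rewrite [b + t *: d - b]addrC addKr (linear_mapZ linb).
set w := E (b + t *: d) - E b - t *: dE b d => Hw.
have wB : `|w| <= K1 * D ^+ 2 * t ^+ 2.
  apply: le_trans Hw _; rewrite -mulrA ler_wpM2l // normrZ gtr0_norm // exprMn mulrC.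
  by rewrite ler_wpM2r ?exprn_ge0 ?(ltW t0) // lerXn2r ?nnegrE ?(ltW D0).
pose v : point := (zeta_k pr n * sn_eps_hat pr, Res.1.1, Res.1.2, Res.2).
pose w' : point := (0, w.1.1, w.1.2, w.2).
have EE : Ehat (b + t *: d) = ((1 - t) *: Ehat b + t *: v) + w'.
  have EbtE : E (b + t *: d) = (1 - t) *: E b + t *: Res + w.
    rewrite /Res scalerDr scalerBl scale1r (addrA (E b - t *: E b)) subrK /w.
    by rewrite -[E _ - _ - _]addrA -opprD [RHS]addrC subrK.
  rewrite !E_hatE EbtE /v /w'.
  have ee : (b + t *: d).1.1.1 = (1 - t) * b.1.1.1 + t * (zeta_k pr n * sn_eps_hat pr).
    by rewrite [LHS]/= deq -[_ *: _]/(_ * _); ring.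
  rewrite ee; exact: residual_comb_point.
have wn : point_norm w' ^+ 2 <= Q * t ^+ 4.
  have -> : Q * t ^+ 4 = (ratio * (K1 * D ^+ 2 * t ^+ 2)) ^+ 2 by rewrite /Q; ring.
  have rt0 : 0 <= ratio by apply: le_trans (norm_ratio_ge1 R N).
  have h : point_norm w' <= ratio * (K1 * D ^+ 2 * t ^+ 2).
    apply: le_trans (point_norm_le _) _; rewrite ler_wpM2l //.
    apply: le_trans wB; rewrite norm_point_le /= normr0 normr_ge0 /=.
    by have [-> -> ->] := residual_coord_le w.
  by rewrite lerXn2r ?nnegrE ?point_norm_ge0 // (le_trans (point_norm_ge0 w')).
have t01 : 0 <= t <= 1 by rewrite (ltW t0).
have cvx := point_norm_convex (Ehat b) v t01.
have sg0 : 0 < t * gam / 2 by rewrite divr_gt0 // mulr_gt0.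
have add := point_normD_sqr ((1 - t) *: Ehat b + t *: v) w' sg0.
rewrite -EE -/n in add cvx.
rewrite /psi -/n.
move: (point_norm (Ehat (b + t *: d))) (point_norm w') (point_norm v)
  (point_norm (_ + _)) wn target cvx add => P1 P2 P3 P4 wn target cvx add.
have mn : 0 < m1 <= n by rewrite m10.
have tt : 0 < t <= 1 by rewrite t0.
apply: (sufficient_decrease d0 d1 s0 s1 Q0 mn tt _ cvx target wn add).
by rewrite mulrC -ler_pdivlMr.
Qed.

End GlobalConvergence.

(** * From the accumulation point to the whole sequence *)

Lemma cluster_seq_near (R : realType) (V : normedModType R) (b : nat -> V) (bs : V) :
  cluster (b @ \oo) bs -> forall (r : R) (k0 : nat), 0 < r ->
  exists2 k, (k0 <= k)%N & `|b k - bs| < r.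
Proof.
move=> cl r k0 r0.
have h1 : (b @ \oo) (b @` [set k | (k0 <= k)%N]).
  by exists k0 => // k kk0; exists k.
have h2 : nbhs bs [set x | `|x - bs| < r].
  apply/nbhs_ballP; exists r => //= x.
  by rewrite -ball_normE /= distrC.
have [x [[k kk0 <-] xr]] := cl _ _ h1 h2.
by exists k.
Qed.

Section SequenceConvergence.
Variables (R : realType) (M1 N M2 : nat) (A : 'M[R]_(M1, N)) (X : 'M[R]_(N, M2)).
Variables (y : 'cV[R]_M2) (kappa : R) (pr : SN_params R).
Hypotheses (kappa_gt0 : 0 < kappa) (pr_ok : SN_params_ok pr).
Local Notation point := (SN_point R N).
Local Notation E := (E_map A X y kappa).
Local Notation Ehat := (E_hat A X y kappa).
Local Notation nE b := (point_norm (E_hat A X y kappa b)).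
Local Notation tau := (sn_tau pr).
Local Notation delta := (SN_delta pr).
Local Notation sigma := (sn_sigma pr).
Local Notation rho := (sn_rho pr).
Variables (b : nat -> point) (bs : point).
Hypothesis b_SN : SN_infinite_sequence A X y kappa pr b.
Hypothesis bs_acc : cluster (b @ \oo) bs.
Hypothesis z_gt0 : z_positive A X y bs.

Lemma SN_nE_gt0 k : 0 < nE (b k).
Proof. by have [_ /(_ k)[h _]] := b_SN; exact: nE_gt0. Qed.

Lemma rhoX_itv l : 0 < rho ^+ l <= 1.
Proof.
have [_ [_ /andP[rh0 rh1] _ _]] := pr_ok.
by rewrite exprn_gt0 // exprn_ile1 // ltW.
Qed.

(** The direction prescribes its [eps] entry exactly, so each step averages [eps] with its target;
    positivity and common lower bounds persist. *)
Lemma SN_eps_step k : exists2 t : R, 0 < t <= 1 &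
  (b k.+1).1.1.1 = (1 - t) * (b k).1.1.1 + t * (zeta_k pr (nE (b k)) * sn_eps_hat pr).
Proof.
have [_ /(_ k)[_ [d [l [[deq _ _] _ _ ->]]]]] := b_SN.
exists (rho ^+ l); first exact: rhoX_itv.
by rewrite [LHS]/= deq -[_ *: _]/(_ * _); ring.
Qed.

Lemma SN_eps_ge (m : R) : 0 < m -> m <= (b 0%N).1.1.1 ->
  (forall k, m <= zeta_k pr (nE (b k)) * sn_eps_hat pr) -> forall k, m <= (b k).1.1.1.
Proof.
move=> m0 b0 H; elim=> [//|k IH].
have [t /andP[t0 t1] ->] := SN_eps_step k.
have h1 : (1 - t) * m <= (1 - t) * (b k).1.1.1 by rewrite ler_wpM2l // subr_ge0.
have h2 := ler_wpM2l (ltW t0) (H k).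
by apply: le_trans (lerD h1 h2); rewrite -mulrDl subrK mul1r.
Qed.

Lemma SN_eps_gt0 k : 0 < (b k).1.1.1.
Proof.
elim: k => [|k IH]; first by case: b_SN.
have [t /andP[t0 t1] ->] := SN_eps_step k.
have [z0 _ _] := zeta_bounds pr_ok (SN_nE_gt0 k).
have [[eh0 _ _ _] _] := pr_ok.
apply: ltr_wpDl; last exact: mulr_gt0 t0 (mulr_gt0 z0 eh0).
by rewrite mulr_ge0 ?subr_ge0 // ltW.
Qed.

Lemma decrease_itv : 0 < 2 * sigma * (1 - delta) < 1.
Proof.
have [[_ _ _ d1] [_ _ /andP[s0 s1] _]] := pr_ok.
have d0 := delta_ge0 pr_ok.
apply/andP; split; first by rewrite !mulr_gt0 // subr_gt0.
nra.
Qed.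

Lemma SN_psi_decr k : psi A X y kappa (b k.+1) <= psi A X y kappa (b k).
Proof.
have [_ /(_ k)[_ [d [l [_ arm _ ->]]]]] := b_SN.
apply: le_trans arm _; rewrite ler_piMl ?sqr_ge0 //.
have /andP[c0 _] := decrease_itv; have /andP[r0 _] := rhoX_itv l.
by rewrite lerBlDr lerDl mulr_ge0 // ltW.
Qed.

Lemma SN_psi_mono k k' : (k <= k')%N ->
  psi A X y kappa (b k') <= psi A X y kappa (b k).
Proof.
move=> /subnK <-; elim: (k' - k)%N => [|j IH]; first by rewrite add0n.
by rewrite addSn; apply: le_trans (SN_psi_decr _) IH.
Qed.

Lemma SN_nE_mono k k' : (k <= k')%N -> nE (b k') <= nE (b k).
Proof.
move=> kk; have := SN_psi_mono kk; rewrite /psi.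
by rewrite ler_pXn2r // nnegrE point_norm_ge0.
Qed.

(* Otherwise [eps] stays away from 0, so the Jacobian is continuous and
   nonsingular at [bs] and the step lengths are bounded below near [bs]: the
   merit function would decrease by a fixed factor infinitely often. *)
Lemma SN_residual_small (m : R) : 0 < m -> exists k, nE (b k) < m.
Proof.
move=> m0; apply: contrapT => /forallNP nEm'.
have nEm k : m <= nE (b k) by rewrite leNgt; apply/negP/nEm'.
have [[eh0 /andP[r0 _] _ _] [_ /andP[rh0 rh1] _ /andP[t0 _]]] := pr_ok.
pose zm := sn_r pr * Num.min 1 (m `^ (1 + tau)) * sn_eps_hat pr.
have zm0 : 0 < zm by rewrite !mulr_gt0 // lt_min ltr01 powR_gt0.
pose em := Num.min (b 0%N).1.1.1 zm.
have em0 : 0 < em by rewrite lt_min SN_eps_gt0.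
have epsm k : em <= (b k).1.1.1.
  move: k; apply: SN_eps_ge => // [|k]; first by rewrite ge_min lexx.
  apply: (@le_trans _ _ zm); first by rewrite ge_min lexx orbT.
  rewrite ler_wpM2r ?(ltW eh0) // ler_wpM2l ?(ltW r0) // le_min ge_min lexx /=.
  rewrite ge_min; apply/orP; right.
  by apply: ge0_ler_powR; rewrite ?nnegrE ?addr_ge0 ?(ltW t0) ?(ltW m0) ?point_norm_ge0.
have es0 : 0 < bs.1.1.1.
  have [k _ kr] := cluster_seq_near bs_acc 0%N em0.
  have [/= h _ _ _] := point_coord_le (b k - bs).
  have := le_lt_trans h kr; rewrite ltr_norml => /andP[_ h'].
  by have := epsm k; lra.
have [r [tm [r_gt0 /andP[tm0 tm1] H]]] :=
  armijo_uniform kappa_gt0 pr_ok (nE (b 0%N)) z_gt0 es0 m0.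
have /andP[c0 c1] := decrease_itv.
set c := 2 * sigma * (1 - delta) in c0 c1 H.
pose q := c * (rho * tm).
have rt0 : 0 < rho * tm by rewrite mulr_gt0.
have rt1 : rho * tm <= 1 by rewrite mulr_ile1 // ltW.
have q0 : 0 < q by rewrite mulr_gt0.
have q1 : q < 1 by rewrite /q; nra.
have step k : `|b k - bs| < r ->
    psi A X y kappa (b k.+1) <= (1 - q) * psi A X y kappa (b k).
  move=> kr; have [_ /(_ k)[Eb0 [d [l [dir arm lmin ->]]]]] := b_SN.
  have bnd : m <= nE (b k) <= nE (b 0%N) by rewrite nEm SN_nE_mono.
  apply: le_trans arm _; rewrite ler_wpM2r ?sqr_ge0 // lerD2l lerN2 -/c.
  rewrite /q ler_wpM2l ?(ltW c0) //.
  (* If [l > 0], the previous trial step was rejected, hence longer than [tm]; one more factor [rho]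
     leaves more than [rho tm]. *)
  case: l lmin => [|l] lmin; first by rewrite expr0.
  rewrite exprS ler_wpM2l ?(ltW rh0) // leNgt; apply/negP => hl.
  apply: (lmin l (ltnSn l)); apply: (H (b k) d) => //.
  - exact: SN_eps_gt0.
  - by have /andP[-> _] := rhoX_itv l; rewrite ltW.
pose S := range (fun k => psi A X y kappa (b k)).
have lbS : has_lbound S.
  by exists 0 => _ [k _ <-]; exact: sqr_ge0.
have infS : has_inf S by split => //; exists (psi A X y kappa (b 0%N)); exists 0%N.
have s0 : 0 < inf S.
  apply: (@lt_le_trans _ _ (m ^+ 2)); first by rewrite exprn_gt0.
  apply: lb_le_inf; first by exists (psi A X y kappa (b 0%N)); exists 0%N.
  move=> _ [k _ <-]; rewrite /psi lerXn2r ?nnegrE ?point_norm_ge0 ?(ltW m0) //.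
(* A late iterate near [bs] has merit below [(1 + q) inf S]; its next step brings it below
   [(1 - q^2) inf S], under the infimum. *)
have qs0 : 0 < q * inf S by rewrite mulr_gt0.
have [_ [k0 _ <-] hk0] := inf_adherent qs0 infS.
have [k kk0 kr] := cluster_seq_near bs_acc k0 r_gt0.
have h1 := SN_psi_mono kk0.
have h2 := step k kr.
have h3 : inf S <= psi A X y kappa (b k.+1) by apply: ge_inf => //; exists k.+1.
have h4 : psi A X y kappa (b k) < inf S + q * inf S by apply: le_lt_trans hk0.
move: (inf S) (psi A X y kappa (b k)) (psi A X y kappa (b k.+1)) s0 h2 h3 h4.
move=> s p p' s_gt0 h2 h3 h4.
have : (1 - q) * p < (1 - q) * (s + q * s) by rewrite ltr_pM2l // subr_gt0.
have -> : (1 - q) * (s + q * s) = s - q ^+ 2 * s by ring.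
have : 0 < q ^+ 2 * s by rewrite mulr_gt0 // exprn_gt0.
lra.
Qed.

Lemma SN_near_small_residual (r m : R) : 0 < r -> 0 < m ->
  exists2 k, `|b k - bs| < r & nE (b k) < m.
Proof.
move=> r0 m0; have [k0 h0] := SN_residual_small m0.
have [k kk0 kr] := cluster_seq_near bs_acc k0 r0.
by exists k => //; apply: le_lt_trans h0; exact: SN_nE_mono.
Qed.

Lemma SN_limit_eps : bs.1.1.1 = 0.
Proof.
apply/eqP; rewrite -normr_eq0 eq_le normr_ge0 andbT; apply/ler_addgt0Pr => e e0; rewrite add0r.
have e20 : 0 < e / 2 by rewrite divr_gt0.
have [k kr kn] := SN_near_small_residual e20 e20.
have [/= h _ _ _] := point_coord_le (b k - bs).
have [h' _] := nE_ge A X y kappa (b k).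
have := ler_normB (b k).1.1.1 ((b k).1.1.1 - bs.1.1.1).
rewrite subKr; lra.
Qed.

(** Values of [E] pass to the limit through the Lipschitz estimate at [bs], available only once
    [SN_limit_eps] is known. *)
Lemma SN_limit_E : E bs = 0.
Proof.
apply/eqP; rewrite -normr_eq0 eq_le normr_ge0 andbT; apply/ler_addgt0Pr => e e0; rewrite add0r.
have [r [L [r0 L0 H]]] := E_map_lipschitz_at kappa_gt0 z_gt0 SN_limit_eps.
have L1 : 0 < L + 1 by rewrite ltr_wpDl.
have e20 : 0 < e / 2 by rewrite divr_gt0.
pose r' := Num.min r (e / 2 / (L + 1)).
have r'0 : 0 < r' by rewrite lt_min r0 divr_gt0.
have [k] := SN_near_small_residual r'0 e20.
rewrite lt_min => /andP[kr kr'] kn.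
have {}H := H _ kr (SN_eps_gt0 k).
have [_ h'] := nE_ge A X y kappa (b k).
have := ler_normB (E (b k)) (E (b k) - E bs).
rewrite subKr => h; apply: le_trans h _.
have : L * `|b k - bs| <= e / 2.
  rewrite ltr_pdivlMr // in kr'; apply: le_trans (ltW kr').
  by rewrite mulrC ler_wpM2l // lerDl.
lra.
Qed.

Theorem SN_superlinear : b @ \oo --> bs /\
  (fun k => point_norm (b k.+1 - bs))
    =O_\oo (fun k => point_norm (b k - bs) `^ (1 + tau)).
Proof.
have [r [c [r0 c0 H]]] :=
  newton_step_accepted kappa_gt0 pr_ok z_gt0 SN_limit_eps SN_limit_E.
have [_ [_ _ _ /andP[t0 _]]] := pr_ok.
have step k : `|b k - bs| < r ->
    `|b k.+1 - bs| <= c * `|b k - bs| `^ (1 + tau) /\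
    `|b k.+1 - bs| <= 2^-1 * `|b k - bs|.
  move=> kr; have [_ /(_ k)[Eb0 [d [l [dir arm lmin ->]]]]] := b_SN.
  have [h1 h2 h3] := H _ _ kr (SN_eps_gt0 k) Eb0 dir.
  (* Acceptance of the full step contradicts the minimality of any positive [l]. *)
  case: l arm lmin => [_ _|l _ lmin]; first by rewrite expr0 scale1r.
  by have := lmin 0%N (ltn0Sn l).
have half_le1 : 2^-1 <= 1 :> R by lra.
(* One iterate in the ball is enough: halving the distance keeps all later ones inside. *)
have [k0 _ kr0] := cluster_seq_near bs_acc 0%N r0.
have geo j : `|b (j + k0)%N - bs| <= 2^-1 ^+ j * `|b k0 - bs|.
  elim: j => [|j IH]; first by rewrite add0n expr0 mul1r.
  have jr : `|b (j + k0)%N - bs| < r.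
    apply: le_lt_trans IH _; apply: le_lt_trans kr0.
    by rewrite ler_piMl // exprn_ile1 // invr_ge0.
  have [_ h] := step _ jr.
  by rewrite addSn exprS -mulrA; apply: le_trans h _; rewrite ler_wpM2l // invr_ge0.
have near_r k : (k0 <= k)%N -> `|b k - bs| < r.
  move=> /subnK <-; apply: le_lt_trans (geo _) _; apply: le_lt_trans kr0.
  by rewrite ler_piMl // exprn_ile1 // invr_ge0.
split.
- apply/cvgrPdist_lt => e e0.
  have half_lt1 : `|2^-1 : R| < 1 by rewrite ger0_norm ?invr_ge0 // invf_lt1 // ltr1n.
  have er0 : 0 < e / r by rewrite divr_gt0.
  have /cvgrPdist_lt/(_ _ er0)[J _ HJ] := cvg_expr half_lt1.
  exists (J + k0)%N => // k /= kJ.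
  have kk0 : (k0 <= k)%N by apply: leq_trans kJ; exact: leq_addl.
  have := HJ (k - k0)%N; rewrite /= leq_subRL // addnC => /(_ kJ).
  rewrite sub0r normrN ger0_norm ?exprn_ge0 ?invr_ge0 // => hj.
  rewrite distrC -(subnK kk0); apply: le_lt_trans (geo _) _.
  apply: (@le_lt_trans _ _ (2^-1 ^+ (k - k0) * r)).
    by rewrite ler_wpM2l ?exprn_ge0 ?invr_ge0 // ltW.
  by rewrite -ltr_pdivlMr.
- apply/eqO_exP; exists (norm_ratio R N * c + 1).
    by rewrite ltr_wpDl // mulr_ge0 // (le_trans _ (norm_ratio_ge1 R N)).
  exists k0 => // k kk0; have [h _] := step k (near_r k kk0).
  rewrite !ger0_norm ?powR_ge0 ?point_norm_ge0 //.
  apply: le_trans (point_norm_le _) _; rewrite [leRHS]mulrDl.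
  apply: ler_wpDr; first by rewrite mul1r powR_ge0.
  rewrite -mulrA ler_wpM2l ?(le_trans _ (norm_ratio_ge1 R N)) //.
  apply: le_trans h _; rewrite ler_wpM2l //.
  apply: ge0_ler_powR; rewrite ?nnegrE ?addr_ge0 ?(ltW t0) ?point_norm_ge0 //.
  exact: norm_le_point_norm.
Qed.

End SequenceConvergence.

Theorem theorem4p4 (R : realType) (T m1 m2 n : nat)
    (T_gt0 : (0 < T)%N) (m1_gt0 : (0 < m1)%N) (m2_gt0 : (0 < m2)%N)
    (n_gt0 : (0 < n)%N)
    (xbar : 'I_T -> 'I_m1 -> 'cV[R]_n) (ybar : 'I_T -> 'I_m1 -> R)
    (xhat : 'I_T -> 'I_m2 -> 'cV[R]_n) (yhat : 'I_T -> 'I_m2 -> R)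
    (ybar_pm1 : forall j i, ybar j i = 1 \/ ybar j i = -1)
    (yhat_pm1 : forall j i, yhat j i = 1 \/ yhat j i = -1)
    (kappa : R) (kappa_gt0 : 0 < kappa)
    (pr : SN_params R) (pr_ok : SN_params_ok pr)
    (b : nat -> SN_point R (\sum_(j < T) n)%N)
    (bs : SN_point R (\sum_(j < T) n)%N)
    (b_SN : SN_infinite_sequence (validation_mx xbar ybar) (training_mx xhat)
              (training_labels yhat) kappa pr b)
    (bs_acc : cluster (b @ \oo) bs)
    (z_gt0 : z_positive (validation_mx xbar ybar) (training_mx xhat)
               (training_labels yhat) bs) :
  b @ \oo --> bs /\
  (fun k => point_norm (b k.+1 - bs))
    =O_\oo (fun k => point_norm (b k - bs) `^ (1 + sn_tau pr)).
Proof. exact: (SN_superlinear kappa_gt0 pr_ok b_SN bs_acc z_gt0). Qed.
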